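(* Let $T\ge1$ be an integer, $0<\epsilon<1$, $\kappa=1-\epsilon^2$, and let $v$ be the value function and $u$ the function defined in the context, with parameters $\sigma=\kappa$ and $b=\sigma/\epsilon=\kappa/\epsilon$ (so that $u$ is the $C^1$ solution of the heat equation in the context). Then $$|u(0,(\epsilon T,\epsilon T),-T)-v(0,(\epsilon T,\epsilon T),-T)|\le E_1(-T),$$ where the error term $E_1(-T)$ is $$O\Big(1+\sqrt\kappa+\Big(\frac{\kappa}{\epsilon}\nu(\epsilon)+\frac{\kappa}{\epsilon}\rho(\epsilon)+1\Big)T\Big),$$ with $$\rho(\epsilon)=\Big(e^{-2\epsilon/\kappa}-1\Big)\frac{1+\epsilon}{2},\qquad \nu(\epsilon)=e^{-2\epsilon/\kappa}\,\frac{1+\epsilon}{2}+e^{2\epsilon/\kappa}\,\frac{1-\epsilon}{2}-1 .$$ When $\epsilon\to0$, the leading order terms of $\frac{\kappa}{\epsilon}\nu$ and $\frac{\kappa}{\epsilon}\rho$ are $$\frac{\kappa}{\epsilon}\nu(\epsilon)\approx 2\epsilon^3\quad\text{and}\quad \frac{\kappa}{\epsilon}\rho(\epsilon)+1\approx\epsilon^2 .$$ Therefore, $E_1(-T)$ is $O(1+\epsilon^2T)$ (as $\epsilon\to0$).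
   Context: $O(\cdot)$ is understood with an absolute constant, independent of $T\ge1$ and $\epsilon\in(0,1)$; for the final bound, as $\epsilon\to0$, with an absolute constant for all sufficiently small $\epsilon$ and all $T\ge1$. The symbol $\approx$ indicates the leading order term as $\epsilon\to0$. State variables: $\eta\in\mathbb R$, $\xi=(\xi^h,\xi^r)\in\mathbb R^2$, time $t\le0$. Let $\mu(\eta,\xi)=\frac12(\eta+|\xi^r+\xi^h|)$. Value function $v$ (final-time regret of the symmetric two-armed Bernoulli bandit with centered rewards, when the myopic player is used, started at time $t$ from state $(\eta,\xi)$): $v(\eta,\xi,0)=\mu(\eta,\xi)$ and, for integers $t\le-1$, $$v(\eta,\xi,t)=\mathbb E\big[v(\eta+d\eta,\xi+d\xi,t+1)\big].$$ Here $g_1,g_2\in\{-1,1\}$ are independent, with $P(g_1=1)=\frac{1+\epsilon}2$ (safe arm 1) and $P(g_2=1)=\frac{1-\epsilon}2$ (risky arm 2); $I\in\{1,2\}$ is independent of $(g_1,g_2)$ and sampled from $p^m(\xi^r,t)$, where $p^m(\xi^r,t)$ equals $(1,0)$ if $\xi^r+\epsilon t>0$, $(\frac12,\frac12)$ if $\xi^r+\epsilon t=0$, and $(0,1)$ if $\xi^r+\epsilon t<0$; and $$d\eta=g_1+g_2-2g_I,\qquad d\xi=\big(g_1\mathbf 1_{\{I=2\}}-g_2\mathbf 1_{\{I=1\}}-\epsilon,\; g_1\mathbf 1_{\{I=1\}}-g_2\mathbf 1_{\{I=2\}}-\epsilon\big).$$ The domain of $v$ is restricted to $(\eta,\xi,t)$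 such that $\eta$, $\xi^h+\epsilon t$, $\xi^r+\epsilon t$ are integers. Function $u$: for $t<0$ and parameters $\sigma,b>0$, $$u(\eta,\xi,t)=u^h(\eta,\xi^r+\xi^h,t)+u^n(\xi^r,t),$$ $$u^h(\eta,z,t)=\frac12\Big(\eta+\int_{\mathbb R}\Phi(z-s,2t)|s|\,ds\Big),\qquad \Phi(s,t)=\frac1{\sqrt{-2\pi\kappa t}}\exp\Big(\frac{s^2}{2\kappa t}\Big),$$ $$u^n(\xi^r,t)=\varphi(\xi^r+\epsilon t)-\hat\varphi(\xi^r,t),\qquad \hat\varphi(\xi^r,t)=\int_{\mathbb R}\Phi(\xi^r-s,t)\varphi(s)\,ds,$$ with $\varphi(y)=-y$ for $y\le0$ and $\varphi(y)=y+b e^{-2\epsilon y/\sigma}-b$ for $y>0$. Heat equation: with $\sigma=\kappa$, $u$ solves $u_t+\frac\kappa2(u_{\xi^h\xi^h}+u_{\xi^r\xi^r})=q(\xi^r,t)$, $u(\eta,\xi,0)=\mu(\eta,\xi)$, where $q=-\epsilon$ if $\xi^r+\epsilon t<0$ and $q=\epsilon$ if $\xi^r+\epsilon t>0$; it is $C^1$ when $b=\kappa/\epsilon$.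
   Formalization: The printed leading-order terms 2ε³ and ε² are false; the formal theorem instead states (κ/ε)ν ≈ (4/3)ε³ and (κ/ε)ρ+1 ≈ (1/3)ε² as ε→0⁺, with all other claims unchanged. *)

(* Defs.v *)
From HB Require Import structures.
From mathcomp Require Import all_boot all_order all_algebra.
From mathcomp Require Import all_classical all_reals all_analysis.

Set Implicit Arguments.
Unset Strict Implicit.
Unset Printing Implicit Defensive.

Import Order.TTheory GRing.Theory Num.Theory.
Import numFieldNormedType.Exports.

Local Open Scope classical_set_scope.
Local Open Scope ring_scope.

Section Bandit.
Context {R : realType}.
Implicit Types (eps kappa sigma b eta t : R) (xi : R * R).

(* A state variable xi : R * R is (xi^h, xi^r), in this order. *)

Definition mu eta xi : R := 2^-1 * (eta + `|xi.2 + xi.1|).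

(* A reward outcome is a boolean, [true] standing for +1 and [false] for -1;
   an arm is a boolean, [true] standing for the safe arm 1 and [false] for the
   risky arm 2. *)
Definition reward (g : bool) : R := if g then 1 else -1.

(* The myopic player's probability of pulling arm 1 at time t; arm 2 is pulled
   with the complementary probability. *)
Definition myopic1 eps xi t : R :=
  if 0 < xi.2 + eps * t then 1
  else if xi.2 + eps * t == 0 then 2^-1
  else 0.

(* Expectation of X g1 g2 I, where g1, g2, I are independent, g1 = +1 with
   probability (1 + eps) / 2, g2 = +1 with probability (1 - eps) / 2, and I is
   sampled from the myopic distribution. *)
Definition expect eps xi t (X : bool -> bool -> bool -> R) : R :=
  \sum_(g1 : bool) \sum_(g2 : bool) \sum_(I : bool)
    bernoulli_pmf ((1 + eps) / 2) g1 * bernoulli_pmf ((1 - eps) / 2) g2 *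
    bernoulli_pmf (myopic1 eps xi t) I * X g1 g2 I.

Definition deta (g1 g2 I : bool) : R :=
  reward g1 + reward g2 - 2 * reward (if I then g1 else g2).

Definition dxi eps (g1 g2 I : bool) : R * R :=
  ((if I then - reward g2 else reward g1) - eps,
   (if I then reward g1 else - reward g2) - eps).

(* The value function with n steps to go, i.e. at time - n. *)
Fixpoint value_to_go eps (n : nat) eta xi : R :=
  if n is m.+1 then
    expect eps xi (- n%:R) (fun g1 g2 I =>
      value_to_go eps m (eta + deta g1 g2 I) (xi + dxi eps g1 g2 I))
  else mu eta xi.

(* Meaningful for times t <= 0, where v_final and v_step below characterize it.
   The recursion makes sense for all real eta and xi; it preserves the domain
   where eta, xi^h + eps t and xi^r + eps t are integers. *)
Definition v eps eta xi (t : int) : R := value_to_go eps `|t|%N eta xi.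

Lemma v_final eps eta xi : v eps eta xi 0 = mu eta xi.
Proof. by []. Qed.

Lemma v_step eps eta xi (t : int) : t <= -1 ->
  v eps eta xi t =
  expect eps xi t%:~R (fun g1 g2 I =>
    v eps (eta + deta g1 g2 I) (xi + dxi eps g1 g2 I) (t + 1)).
Proof.
case: t => [//|n] _; rewrite /v NegzE abszN /= addrC subzSS sub0r abszN /=.
by rewrite mulrNz.
Qed.

Definition kappa_of eps : R := 1 - eps ^+ 2.

(* Heat kernel, for t < 0: the centered Gaussian density of variance
   - kappa t. *)
Definition Phi kappa (s t : R) : R :=
  (Num.sqrt (- 2 * pi * kappa * t))^-1 * expR (s ^+ 2 / (2 * kappa * t)).

Definition phi eps sigma b (y : R) : R :=
  if y <= 0 then - y else y + b * expR (- 2 * eps * y / sigma) - b.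

Definition phihat eps kappa sigma b (xr t : R) : R :=
  \int[lebesgue_measure]_s (Phi kappa (xr - s) t * phi eps sigma b s).

Definition u_h kappa eta (z t : R) : R :=
  2^-1 * (eta + \int[lebesgue_measure]_s (Phi kappa (z - s) (2 * t) * `|s|)).

Definition u_n eps kappa sigma b (xr t : R) : R :=
  phi eps sigma b (xr + eps * t) - phihat eps kappa sigma b xr t.

Definition u eps kappa sigma b eta xi t : R :=
  u_h kappa eta (xi.2 + xi.1) t + u_n eps kappa sigma b xi.2 t.

Definition rho eps : R :=
  (expR (- 2 * eps / kappa_of eps) - 1) * ((1 + eps) / 2).

Definition nu eps : R :=
  expR (- 2 * eps / kappa_of eps) * ((1 + eps) / 2)
  + expR (2 * eps / kappa_of eps) * ((1 - eps) / 2) - 1.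

(* As eps -> 0, kappa / eps * nu = 4/3 eps^3 + o(eps^3) and
   kappa / eps * rho + 1 = 1/3 eps^2 + o(eps^2).  Truncating the exponentials
   at second order in 2 eps / kappa yields instead the constants 2 and 1, but
   the third and fourth order terms contribute at the same order in eps. *)

End Bandit.

(* Main.v *)
Require Import Defs.
From HB Require Import structures.
From mathcomp Require Import all_boot all_order all_algebra.
From mathcomp Require Import all_classical all_reals all_analysis.
From mathcomp Require Import measurable_realfun ring lra.

Set Implicit Arguments.
Unset Strict Implicit.
Unset Printing Implicit Defensive.

Import Order.TTheory GRing.Theory Num.Theory.
Import numFieldNormedType.Exports.

Local Open Scope classical_set_scope.
Local Open Scope ring_scope.

(* Under the myopic player both xi^h + xi^r and xi^r are centered random walks
   built from +-1 steps of mean eps.  Hence the value function is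
   E|W_{2T}| / 2 - E phi(W_T), up to an error of at most T times the one-step
   defect of phi, which is at most b nu, b rho + 1 or 0 (b = kappa / eps)
   according to the sign of xi^r + eps t.  The function u is the same expression
   with Gaussians of the same mean and variance in place of the walks.
   For |. - a| the Gaussian expectation is explicit, and replacing the n-th step
   of the walk by a Gaussian one costs O(eps / n + n^(-3/2)), the eps / n being
   due to the skewness of the steps; this sums to O(1 + eps^2 T).
   Up to O(1), phi is a mixture with geometric weights of the functions |. - i|,
   so the same bound holds for phi.  Finally b rho + 1 >= eps^2 / 12 lets the
   term eps^2 T be absorbed in the claimed error. *)

(** * Differentiation rules and Taylor's inequality *)

Section Taylor.
Context {R : realType}.
Implicit Types (f : nat -> R -> R) (x h M : R) (n : nat).

(** Lets the rules below produce a derivative in any form, its value being matched afterwards by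
    [ring] or [field]. *)
Lemma der_eq (f : R -> R) (x a b : R) :
  is_derive x 1 f a -> a = b -> is_derive x 1 f b.
Proof. by move=> + <-. Qed.

Lemma der_cst (c x : R) : is_derive x 1 (fun=> c) 0.
Proof. exact: is_derive_cst. Qed.

Lemma der_id (x : R) : is_derive x 1 (fun y => y) 1.
Proof. exact: is_derive_id. Qed.

Lemma derD (f g : R -> R) (x a b : R) : is_derive x 1 f a ->
  is_derive x 1 g b -> is_derive x 1 (fun y => f y + g y) (a + b).
Proof. exact: is_deriveD. Qed.

Lemma derB (f g : R -> R) (x a b : R) : is_derive x 1 f a ->
  is_derive x 1 g b -> is_derive x 1 (fun y => f y - g y) (a - b).
Proof. exact: is_deriveB. Qed.

Lemma derM (f g : R -> R) (x a b : R) : is_derive x 1 f a ->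
  is_derive x 1 g b -> is_derive x 1 (fun y => f y * g y) (f x * b + g x * a).
Proof. exact: is_deriveM. Qed.

Lemma derZ (c : R) (f : R -> R) (x a : R) : is_derive x 1 f a ->
  is_derive x 1 (fun y => c * f y) (c * a).
Proof. by move=> fa; exact: is_deriveZ. Qed.

Lemma derX (f : R -> R) n (x a : R) : is_derive x 1 f a ->
  is_derive x 1 (fun y => f y ^+ n) (n%:R * f x ^+ n.-1 * a).
Proof.
move=> fa; have := is_deriveX n fa.
by rewrite (_ : f ^+ n = (fun y => f y ^+ n))//; apply/funext => y; rewrite exprfctE.
Qed.

Lemma der_comp (f g : R -> R) (x a b : R) : is_derive (g x) 1 f a ->
  is_derive x 1 g b -> is_derive x 1 (fun y => f (g y)) (a * b).
Proof. exact: is_derive1_comp. Qed.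

Lemma der_sum n (f : 'I_n -> R -> R) (x : R) (df : 'I_n -> R) :
  (forall i, is_derive x 1 (f i) (df i)) ->
  is_derive x 1 (fun y => \sum_(i < n) f i y) (\sum_(i < n) df i).
Proof.
move=> fdf; have := is_derive_sum fdf.
by rewrite (_ : \sum_(i < n) f i = (fun y => \sum_(i < n) f i y))//;
  apply/funext => y; rewrite fct_sumE.
Qed.

Lemma MVT01_le (r dr : R -> R) (M : R) :
  (forall t : R, 0 <= t <= 1 -> is_derive t 1 r (dr t)) ->
  (forall t : R, 0 <= t <= 1 -> `|dr t| <= M) ->
  `|r 1 - r 0| <= M.
Proof.
move=> rdr drM.
have [||c] := @MVT_segment R r dr 0 1 ler01.
- by move=> t; rewrite in_itv/= => /andP[t0 t1]; apply: rdr; rewrite !ltW.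
- apply: derivable_within_continuous => t; rewrite in_itv/= => t01.
  by have := rdr t t01; case.
- by rewrite in_itv/= => c01 ->; rewrite subr0 mulr1 drM.
Qed.

(** [f k] plays the k-th derivative of [f 0]. Induction on [n]: along the segment the remainder has
    derivative [h] times the order-[n] remainder of [f 1], and the mean value theorem on [0, 1]
    concludes. The powers are not integrated, so the bound carries no factorial. *)
Lemma taylor_le f n x h M :
  (forall k (t : R), (k < n)%N -> 0 <= t <= 1 ->
     is_derive (x + t * h) 1 (f k) (f k.+1 (x + t * h))) ->
  (forall t : R, 0 <= t <= 1 -> `|f n (x + t * h)| <= M) ->
  `|f 0%N (x + h) - \sum_(k < n) f k x * h ^+ k / k`!%:R| <= M * `|h| ^+ n.
Proof.
elim: n f h => [|n IH] f h df fM.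
  rewrite big_ord0 subr0 expr0 mulr1.
  by have := fM 1; rewrite mul1r; apply; rewrite ler01 lexx.
pose r t := f 0%N (x + t * h) -
  \sum_(k < n.+1) f k x * (t * h) ^+ k / k`!%:R.
pose dr t := h * (f 1%N (x + t * h) -
  \sum_(k < n) f k.+1 x * (t * h) ^+ k / k`!%:R).
have r0 : r 0 = 0.
  rewrite /r mul0r addr0 big_ord_recl/= expr0 fact0 divr1 mulr1.
  rewrite big1 ?addr0 ?subrr// => i _.
  by rewrite exprS mul0r mulr0 mul0r.
have -> : f 0%N (x + h) - \sum_(k < n.+1) f k x * h ^+ k / k`!%:R = r 1 - r 0.
  by rewrite r0 subr0 /r mul1r.
apply: (@MVT01_le r dr) => [t t01|t t01].
- rewrite /r /dr.
  have d1 : is_derive t 1 (fun t0 => x + t0 * h) h.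
    have := derD (der_cst x t) (derM (der_id t) (der_cst h t)).
    by rewrite add0r mulr0 add0r mulr1.
  have dk (k : 'I_n.+1) : is_derive t 1
      (fun t0 : R => f k x * (t0 * h) ^+ k / k`!%:R)
      (f k x * (k%:R * (t * h) ^+ k.-1 * h) / k`!%:R).
    have th := derM (der_id t) (der_cst h t).
    have := derM (derM (der_cst (f k x) t) (derX k th)) (der_cst (k`!%:R^-1) t).
    by rewrite !mulr0 mulr1 addr0 add0r add0r mulrC.
  have dd := derB (@der_comp (f 0%N) (fun t0 => x + t0 * h) t _ _ (df 0%N t (ltn0Sn _) t01) d1)
    (der_sum dk).
  apply: (der_eq dd).
  rewrite mulrBr; congr (_ - _); first by rewrite mulrC.
  rewrite big_ord_recl/= !mul0r mulr0 mul0r add0r mulr_sumr; apply: eq_bigr => i _.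
  rewrite /bump/= add1n factS natrM.
  have i0 : (i`!%:R : R) != 0 by rewrite pnatr_eq0 -lt0n fact_gt0.
  have i1 : (i.+1%:R : R) != 0 by rewrite pnatr_eq0.
  by field; rewrite i0 /= addrC natr1 i1.
- rewrite /dr normrM exprS mulrCA ler_wpM2l//.
  apply: (le_trans (IH (fun k => f k.+1) (t * h) _ _)).
  + move=> k s kn s01; rewrite mulrA; apply: df => //.
    by move: t01 s01 => /andP[? ?] /andP[? ?]; rewrite mulr_ge0// mulr_ile1.
  + move=> s s01; rewrite mulrA; apply: fM.
    by move: t01 s01 => /andP[? ?] /andP[? ?]; rewrite mulr_ge0// mulr_ile1.
  + have M0 : 0 <= M by apply: le_trans (fM 0 _); rewrite // lexx ler01.
    rewrite ler_wpM2l// lerXn2r// ?nnegrE// normrM ler_piMl//.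
    by move: t01 => /andP[? ?]; rewrite ger0_norm.
Qed.

End Taylor.

(** * The standard Gaussian density, its tail, and the mean of |z + Z| *)

Section Gaussian.
Context {R : realType}.
Implicit Types (w x y z m s : R).
Local Notation leb := (@lebesgue_measure R).

Definition gd z : R := normal_pdf 0 1 z.

Definition gtail z : R := 1 - \int[leb]_(t in `]-oo, z]) gd t.

Lemma gdE z : gd z = (Num.sqrt (pi *+ 2))^-1 * expR (- (z ^+ 2 / 2)).
Proof.
rewrite /gd normal_pdfE ?oner_eq0// /normal_peak /normal_fun subr0.
by rewrite expr1n mul1r mulNr.
Qed.

Lemma normal_pdf_gd m s y : 0 < s ->
  normal_pdf m s y = s^-1 * gd ((y - m) / s).
Proof.
move=> s0; rewrite gdE normal_pdfE ?gt_eqF// /normal_peak /normal_fun.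
rewrite -mulrnAr sqrtrM ?sqr_ge0// sqrtr_sqr gtr0_norm// invfM -mulrA.
congr (_ * (_ * expR _)); rewrite -mulr_natr; field.
by rewrite gt_eqF.
Qed.

Lemma gd_ge0 z : 0 <= gd z. Proof. exact: normal_pdf_ge0. Qed.

Let pi2_gt0 : 0 < (pi : R) *+ 2.
Proof. by rewrite pmulrn_lgt0// pi_gt0. Qed.

Lemma gd_le z : gd z <= expR (- (z ^+ 2 / 2)).
Proof.
rewrite gdE ler_piMl ?expR_ge0// invf_le1 ?sqrtr_gt0//.
rewrite -[leLHS]sqrtr1 ler_wsqrtr// -mulr_natr.
by have := @pi_ge2 R; lra.
Qed.

Lemma is_derive_gd z : is_derive z 1 gd (- z * gd z).
Proof.
have -> : gd = fun z => (Num.sqrt (pi *+ 2))^-1 * expR (- 2^-1 * z ^+ 2).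
  by apply/funext => y; rewrite gdE; congr (_ * expR _); rewrite mulNr mulrC.
have d2 := derX 2 (der_id z).
have de := @der_comp R _ _ z _ _ (is_derive_expR (- 2^-1 * z ^+ 2)) (derZ (- 2^-1) d2).
apply: (der_eq (derZ _ de)) => /=; rewrite expr1; field.
by rewrite gt_eqF// sqrtr_gt0.
Qed.

Lemma is_derive_gtail z : is_derive z 1 gtail (- gd z).
Proof.
have z1 : z < z + 1 by rewrite ltrDl.
have ig : leb.-integrable `]-oo, (z + 1)] (EFin \o gd).
  by apply: integrableS (integrable_normal_pdf 0 1).
have [||dF F'] := @continuous_FTC1 R gd -oo%O z (z + 1) z1 ig.
  exact: ltNyr.
  by apply: continuous_normal_pdf; rewrite oner_eq0.
have dd : is_derive z 1 (fun x => \int[leb]_(t in `]-oo, x]) gd t) (gd z).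
  by split => //; rewrite -derive1E.
by have := derB (der_cst 1 z) dd; rewrite sub0r.
Qed.

(** The identity as a random variable under the standard normal law: its distribution function is
    the integral in [gtail], whose limit at infinity is thus 1. *)
Let idTR : measurableTypeR R -> R := idfun.

#[local] HB.instance Definition _ :=
  @isMeasurableFun.Build _ _ _ _ idTR (@measurable_id _ _ setT).

Lemma cvg_gtail : gtail z @[z --> +oo] --> 0.
Proof.
rewrite -(subrr 1); apply: cvgB; first exact: cvg_cst.
exact/fine_cvg/(@cvg_cdfy1 _ _ _ (normal_prob 0 1) idTR).
Qed.

Lemma cvg_gd : gd z @[z --> +oo] --> 0.
Proof.
apply: (@squeeze_cvgr _ _ _ _ (cst 0) (fun z => expR (- z)) gd).
- near=> z; rewrite gd_ge0/= (le_trans (gd_le z))// ler_expR lerN2.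
  (* From 2 on, [z ^+ 2 / 2] dominates [z]. *)
  have : 2 <= z by near: z; exact: nbhs_pinfty_ge.
  by rewrite expr2; nra.
- exact: cvg_cst.
- exact: cvgr_expR.
Unshelve. all: by end_near. Qed.

(* The mean of |z + Z| for a standard Gaussian Z. *)
Definition gabs z : R := 2 * gd z - z * (gtail z - gtail (- z)).

(** The terms in [z * gd z] cancel, leaving the mean of sgn(z + Z). *)
Lemma is_derive_gabs z : is_derive z 1 gabs (gtail (- z) - gtail z).
Proof.
have dN := @der_comp R _ _ z _ _ (is_derive_gtail (- z)) (is_deriveNid z 1).
have := derB (derZ 2 (is_derive_gd z))
  (derM (der_id z) (derB (is_derive_gtail z) dN)).
move/der_eq; apply; have -> : gd (- z) = gd z by rewrite !gdE sqrrN.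
by ring.
Qed.

Lemma is_derive_gabs1 z :
  is_derive z 1 (fun z => gtail (- z) - gtail z) (2 * gd z).
Proof.
have dN := @der_comp R _ _ z _ _ (is_derive_gtail (- z)) (is_deriveNid z 1).
move/der_eq: (derB dN (is_derive_gtail z)); apply.
have -> : gd (- z) = gd z by rewrite !gdE sqrrN.
by ring.
Qed.

Lemma is_derive_gabs2 z :
  is_derive z 1 (fun z => 2 * gd z) (- 2 * z * gd z).
Proof. by move/der_eq: (derZ 2 (is_derive_gd z)); apply; ring. Qed.

Lemma is_derive_gabs3 z :
  is_derive z 1 (fun z => - 2 * z * gd z) (2 * (z ^+ 2 - 1) * gd z).
Proof.
move/der_eq: (derM (derZ (- 2) (der_id z)) (is_derive_gd z)); apply; ring.
Qed.

Lemma gd_le1 z : gd z <= 1.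
Proof.
by rewrite (le_trans (gd_le z))// expR_le1 oppr_le0 divr_ge0 ?sqr_ge0.
Qed.

(** Holds because [gd z <= 1 / e] with [e = expR (z ^+ 2 / 2)], which is at least
    [1 + z ^+ 2 / 2]. *)
Lemma sqr_gd_le z : z ^+ 2 * gd z <= 2.
Proof.
have := gd_le z; have := gd_ge0 z; rewrite expRN.
have := expR_ge1Dx (z ^+ 2 / 2); have := sqr_ge0 z.
set e := expR _; set z2 := z ^+ 2 => z0 e1 g0 ge.
have e0 : 0 < e by rewrite (lt_le_trans _ e1)//; lra.
have : gd z * e <= 1 by rewrite -ler_pdivlMr// div1r.
by nra.
Qed.

Lemma norm_gd_le z : `|z * gd z| <= 2.
Proof.
rewrite normrM (ger0_norm (gd_ge0 z)).
have := sqr_gd_le z; have := gd_le1 z; have := gd_ge0 z.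
rewrite -(real_normK (num_real z)); have := sqr_ge0 (`|z| - 1).
move: (gd z) (`|z|) => g a; rewrite !expr2; nra.
Qed.

End Gaussian.

(** * Explicit Gaussian integrals of |y - a| *)

Section GaussianExpectation.
Context {R : realType}.
Implicit Types (w x y z m s : R).
Local Notation leb := (@lebesgue_measure R).

Definition gauss m s (f : R -> R) : R :=
  \int[leb]_y (normal_pdf m s y * f y).

Let continuous_pdf_mul m s (f : R -> R) : 0 < s -> continuous f ->
  continuous (fun y => normal_pdf m s y * f y).
Proof.
move=> s0 cf y; apply: cvgM; last exact: cf.
by apply: continuous_normal_pdf; rewrite gt_eqF.
Qed.

(** The integrand has the antiderivative [F], built from [gd] and [gtail]; it vanishes at infinity,
    so the integral is [- F a]. *)
Lemma integral_pdf_right m s a : 0 < s ->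
  (\int[leb]_(y in `[a, +oo[) (normal_pdf m s y * (y - a))%:E =
  (s * gd ((a - m) / s) + (m - a) * gtail ((a - m) / s))%:E)%E.
Proof.
move=> s0; pose F y := - (s * gd ((y - m) / s) + (m - a) * gtail ((y - m) / s)).
have dF y : is_derive y 1 F (normal_pdf m s y * (y - a)).
  have dW : is_derive y 1 (fun y => (y - m) / s) s^-1.
    have := derM (derB (der_id y) (der_cst m y)) (der_cst s^-1 y).
    by rewrite mulr0 add0r subr0 mulr1.
  have dg := @der_comp R _ _ y _ _ (is_derive_gd ((y - m) / s)) dW.
  have dt := @der_comp R _ _ y _ _ (is_derive_gtail ((y - m) / s)) dW.
  move/der_eq: (derZ (-1) (derD (derZ s dg) (derZ (m - a) dt))) => dd.
  have -> : F = (fun y => -1 *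
     (s * gd ((y - m) / s) + (m - a) * gtail ((y - m) / s))).
    by apply/funext => z; rewrite mulN1r.
  apply: dd; rewrite normal_pdf_gd//; field; rewrite gt_eqF//.
have cF y : {for y, continuous F}.
  by apply/differentiable_continuous/derivable1_diffP; case: (dF y).
have cW : (y - m) / s @[y --> +oo] --> +oo.
  by apply: gt0_cvgMly; [rewrite invr_gt0|exact: cvg_addrr].
rewrite (@ge0_continuous_FTC2y _ _ F a 0).
- by rewrite /F EFinN sub0e oppeK.
- by move=> y ay; rewrite mulr_ge0 ?normal_pdf_ge0// subr_ge0.
- apply: continuous_subspaceT; apply: continuous_pdf_mul => // y.
  by apply: cvgB; [exact: cvg_id|exact: cvg_cst].
- rewrite -oppr0; apply: cvgN.
  have -> : (0 : R) = s * 0 + (m - a) * 0 by rewrite !mulr0 addr0.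
  apply: cvgD; (apply: cvgM; first exact: cvg_cst).
    exact: cvg_comp cW cvg_gd.
  exact: cvg_comp cW cvg_gtail.
- by move=> y _; case: (dF y).
- exact/cvg_at_right_filter/cF.
- by move=> y _; rewrite derive1E; case: (dF y).
Qed.

(** The reflection y -> -y reduces this to the right half-line with mean [- m]. *)
Lemma integral_pdf_left m s a : 0 < s ->
  (\int[leb]_(y in `]-oo, a]) (normal_pdf m s y * (a - y))%:E =
  (s * gd ((a - m) / s) - (m - a) * gtail (- ((a - m) / s)))%:E)%E.
Proof.
move=> s0; have pN y : normal_pdf m s (- y) = normal_pdf (- m) s y.
  by rewrite !(normal_pdf_gd _ _ s0) !gdE -opprD mulNr sqrrN opprK.
rewrite -[a in `]-oo, a]]opprK ge0_integration_by_substitutionNy.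
- transitivity (\int[leb]_(y in `[(- a)%R, +oo[)
     (normal_pdf (- m) s y * (y - - a))%:E)%E.
    by apply: eq_integral => y _ /=; rewrite pN !opprK addrC.
  rewrite integral_pdf_right//; congr (_%:E).
  have -> : (- a - - m) / s = - ((a - m) / s) by field; rewrite gt_eqF.
  have -> : gd (- ((a - m) / s)) = gd ((a - m) / s) by rewrite !gdE sqrrN.
  by ring.
- apply: continuous_subspaceT; apply: continuous_pdf_mul => // y.
  by apply: cvgB; [exact: cvg_cst|exact: cvg_id].
- move=> y; rewrite in_itv/= opprK => ya.
  by rewrite mulr_ge0 ?normal_pdf_ge0// subr_ge0 ltW.
Qed.

Lemma integral_pdf_abs m s a : 0 < s ->
  (\int[leb]_y (normal_pdf m s y * `|y - a|)%:E =
   (s * gabs ((a - m) / s))%:E)%E.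
Proof.
move=> s0; have mabs : measurable_fun [set: R]
    (fun y => normal_pdf m s y * `|y - a|).
  apply: measurable_funM; first exact: measurable_normal_pdf.
  by apply: measurableT_comp => //; exact: measurable_funB.
have -> : [set: R] = `]-oo, a] `|` `]a, +oo[.
  by rewrite -setCitvr setvU.
rewrite ge0_integral_setU//=; first last.
- rewrite disj_set2E; apply/eqP; rewrite -setCitvr; exact: setICl.
- by move=> y _; rewrite lee_fin mulr_ge0// normal_pdf_ge0.
- exact/measurable_funTS/measurable_EFinP.
rewrite integral_itv_obnd_cbnd; last first.
  exact/measurable_funTS/measurable_EFinP.
transitivity (\int[leb]_(y in `]-oo, a]) (normal_pdf m s y * (a - y))%:E +
  \int[leb]_(y in `[a, +oo[) (normal_pdf m s y * (y - a))%:E)%E.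
  congr (_ + _)%E; apply: eq_integral => y; rewrite inE/= in_itv/= ?andbT => ya.
    by rewrite distrC ger0_norm// subr_ge0.
  by rewrite ger0_norm// subr_ge0.
rewrite integral_pdf_left// integral_pdf_right// -EFinD; congr (_%:E).
by rewrite /gabs; field; rewrite gt_eqF.
Qed.

End GaussianExpectation.

(** * Linearity and monotonicity of the Gaussian expectation *)

Section GaussianExpectationTheory.
Context {R : realType}.
Implicit Types (x y z m s a c D : R) (f g h : R -> R).
Local Notation leb := (@lebesgue_measure R).

Definition gauss_integrable m s f : Prop :=
  leb.-integrable setT (EFin \o (fun y => normal_pdf m s y * f y)).

Lemma gauss_integrable_abs m s a : 0 < s ->
  gauss_integrable m s (fun y => `|y - a|).
Proof.
move=> s0; apply/integrableP; split.
  apply/measurable_EFinP/measurable_funM; first exact: measurable_normal_pdf.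
  by apply: measurableT_comp => //; exact: measurable_funB.
under eq_integral do rewrite /= ger0_norm ?mulr_ge0 ?normal_pdf_ge0//.
by rewrite /= integral_pdf_abs// ltry.
Qed.

Lemma gauss_integrable_cst m s c : gauss_integrable m s (fun=> c).
Proof.
have := integrableZr measurableT c (integrable_normal_pdf m s).
by apply: eq_integrable => // y _; rewrite /= EFinM.
Qed.

Lemma gauss_integrableD m s f g : gauss_integrable m s f ->
  gauss_integrable m s g -> gauss_integrable m s (fun y => f y + g y).
Proof.
move=> fi gi; have := integrableD measurableT fi gi.
by apply: eq_integrable => // y _; rewrite /= -EFinD mulrDr.
Qed.

Lemma gauss_integrableZ m s c f : gauss_integrable m s f ->
  gauss_integrable m s (fun y => c * f y).
Proof.
move=> fi; have := integrableZl measurableT c fi.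
by apply: eq_integrable => // y _; rewrite /= -EFinM mulrCA.
Qed.

Lemma gauss_integrable_sum m s (I : Type) (r : seq I) (F : I -> R -> R) :
  (forall i, gauss_integrable m s (F i)) ->
  gauss_integrable m s (fun y => \sum_(i <- r) F i y).
Proof.
move=> Fi; elim: r => [|i r IH].
  have := gauss_integrable_cst m s 0; apply: eq_integrable => // y _ /=.
  by rewrite big_nil.
have := gauss_integrableD (Fi i) IH; apply: eq_integrable => // y _ /=.
by rewrite big_cons.
Qed.

Lemma gauss_integrable_le m s f g : measurable_fun setT f ->
  gauss_integrable m s g -> (forall y, `|f y| <= g y) ->
  gauss_integrable m s f.
Proof.
move=> mf gi fg; apply: le_integrable gi => //.
  by apply/measurable_EFinP/measurable_funM => //; exact: measurable_normal_pdf.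
move=> y _ /=; rewrite lee_fin !normrM ler_wpM2l//.
by rewrite (le_trans (fg y))// ler_norm.
Qed.

Lemma gauss_cst m s c : gauss m s (fun=> c) = c.
Proof.
rewrite /gauss RintegralZr//; last exact: integrable_normal_pdf.
by rewrite /Rintegral integral_normal_pdf mul1r.
Qed.

Lemma gauss_abs m s a : 0 < s ->
  gauss m s (fun y => `|y - a|) = s * gabs ((a - m) / s).
Proof. by move=> s0; rewrite /gauss /Rintegral integral_pdf_abs. Qed.

Lemma gaussD m s f g : gauss_integrable m s f -> gauss_integrable m s g ->
  gauss m s (fun y => f y + g y) = gauss m s f + gauss m s g.
Proof.
move=> fi gi; rewrite /gauss -RintegralD//.
by apply: eq_Rintegral => y _; rewrite mulrDr.
Qed.

Lemma gaussZ m s c f : gauss_integrable m s f ->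
  gauss m s (fun y => c * f y) = c * gauss m s f.
Proof.
move=> fi; rewrite /gauss -RintegralZl//.
by apply: eq_Rintegral => y _; rewrite mulrCA.
Qed.

Lemma gauss_sum m s (I : Type) (r : seq I) (F : I -> R -> R) :
  (forall i, gauss_integrable m s (F i)) ->
  gauss m s (fun y => \sum_(i <- r) F i y) = \sum_(i <- r) gauss m s (F i).
Proof.
move=> Fi; elim: r => [|i r IH].
  rewrite big_nil -[RHS](gauss_cst m s).
  by apply: eq_Rintegral => y _; rewrite big_nil.
rewrite big_cons -IH -gaussD//; last exact: gauss_integrable_sum.
by apply: eq_Rintegral => y _; rewrite big_cons.
Qed.

Lemma ler_gauss m s f g : gauss_integrable m s f -> gauss_integrable m s g ->
  (forall y, f y <= g y) -> gauss m s f <= gauss m s g.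
Proof.
move=> fi gi fg; apply: le_Rintegral => // y _.
by rewrite ler_wpM2l// normal_pdf_ge0.
Qed.

Lemma gauss_dist_le m s f g D : gauss_integrable m s f ->
  gauss_integrable m s g -> (forall y, `|f y - g y| <= D) ->
  `|gauss m s f - gauss m s g| <= D.
Proof.
move=> fi gi fgD; rewrite ler_distl; apply/andP; split.
  rewrite lerBlDr -[X in _ + X](gauss_cst m s) -gaussD//.
    apply: ler_gauss => //.
      by apply: gauss_integrableD => //; exact: gauss_integrable_cst.
    by move=> y; have := fgD y; rewrite ler_distl lerBlDr => /andP[].
  exact: gauss_integrable_cst.
rewrite -[X in _ + X](gauss_cst m s) -gaussD//.
  apply: ler_gauss => //.
    by apply: gauss_integrableD => //; exact: gauss_integrable_cst.
  by move=> y; have := fgD y; rewrite ler_distl => /andP[].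
exact: gauss_integrable_cst.
Qed.

(** [s * gabs (z / s)] is the mean of |Y - z| for Y centered Gaussian of standard deviation [s]. By
    the triangle inequality it differs from |z| by at most E|Y| <= 2 s. *)
Lemma gabs_dist z s : 0 < s -> `|s * gabs (z / s) - `|z| | <= 2 * s.
Proof.
move=> s0; have := gauss_abs 0 z s0; rewrite subr0 => <-.
have g0 := gauss_integrable_abs 0 0 s0.
have gz := gauss_integrable_abs 0 z s0.
have gc := gauss_integrable_cst 0 s `|z|.
have e0 : gauss 0 s (fun y => `|y - 0|) <= 2 * s.
  rewrite gauss_abs// subrr mul0r /gabs mul0r subr0 mulrC ler_pM2r//.
  by have := gd_le1 (0 : R); lra.
rewrite ler_distl; apply/andP; split.
  rewrite lerBlDr -[leLHS](gauss_cst 0 s).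
  apply: (le_trans (ler_gauss gc (gauss_integrableD gz g0) _)).
    by move=> y; have := ler_normB y (y - z); rewrite subr0 subKr addrC.
  by rewrite gaussD// lerD2l.
apply: (le_trans (ler_gauss gz (gauss_integrableD gc g0) _)).
  by move=> y; rewrite subr0 addrC -[`|z|]normrN ler_normD.
by rewrite gaussD// gauss_cst lerD2l.
Qed.

End GaussianExpectationTheory.

(** * The centered walk and its one-step comparison with a Gaussian *)

Section CentralLimit.
Context {R : realType}.
Implicit Types (eps a x y z s w D : R) (f g : R -> R) (n : nat).

(* Transition operator of the centered walk with steps g - eps, where g = +1
   with probability (1 + eps) / 2 and g = -1 otherwise. *)
Definition walk eps f x : R :=
  (1 + eps) / 2 * f (x + (1 - eps)) + (1 - eps) / 2 * f (x - (1 + eps)).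

Lemma walk_dist_le eps f g x D : 0 <= eps -> eps <= 1 ->
  `|f (x + (1 - eps)) - g (x + (1 - eps))| <= D ->
  `|f (x - (1 + eps)) - g (x - (1 + eps))| <= D ->
  `|walk eps f x - walk eps g x| <= D.
Proof.
move=> e0 e1; rewrite /walk.
move: (f (x + _)) (g (x + _)) (f (x - _)) (g (x - _)) => f1 g1 f2 g2.
by rewrite !ler_distl => /andP[? ?] /andP[? ?]; apply/andP; split; nra.
Qed.

Lemma iter_walk_sum eps n (I : Type) (r : seq I) (F : I -> R -> R) x :
  iter n (walk eps) (fun y => \sum_(i <- r) F i y) x =
  \sum_(i <- r) iter n (walk eps) (F i) x.
Proof.
elim: n x => [//|n IH] x.
by rewrite iterS {1}/walk !IH !mulr_sumr -big_split.
Qed.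

Lemma iter_walkZ eps n c f x :
  iter n (walk eps) (fun y => c * f y) x = c * iter n (walk eps) f x.
Proof. by elim: n x => [//|n IH] x; rewrite !iterS /walk !IH; ring. Qed.

Lemma iter_walkD eps n f c x :
  iter n (walk eps) (fun y => f y + c) x = iter n (walk eps) f x + c.
Proof. by elim: n x => [//|n IH] x; rewrite !iterS /walk !IH; field. Qed.

Lemma iter_walk_dist_le eps n f g x D : 0 <= eps -> eps <= 1 ->
  (forall y, `|f y - g y| <= D) ->
  `|iter n (walk eps) f x - iter n (walk eps) g x| <= D.
Proof.
by move=> e0 e1 fg; elim: n x => [//|n IH] x; rewrite !iterS; exact: walk_dist_le.
Qed.

(** |. - a| is 1-Lipschitz and a step has length at most 2. This crude bound serves for a single
    step and for [eps] bounded away from 0. *)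
Lemma iter_walk_abs_dist eps n a x : 0 <= eps -> eps <= 1 ->
  `|iter n (walk eps) (fun y => `|y - a|) x - `|x - a| | <= 2 * n%:R.
Proof.
move=> e0 e1; elim: n x => [|n IH] x; first by rewrite subrr normr0 mulr0.
rewrite iterS -[n.+1%:R]natr1 mulrDr mulr1.
have step h : `|h| <= 2 ->
    `|iter n (walk eps) (fun y => `|y - a|) (x + h) - `|x - a| | <= 2 * n%:R + 2.
  move=> h2; rewrite -[X in `|X|](subrKA `|x + h - a|).
  rewrite (le_trans (ler_normD _ _))// lerD// (le_trans (ler_dist_dist _ _))//.
  by rewrite (_ : _ - (x - a) = h)//; ring.
rewrite [X in `|_ - X|](_ : _ = walk eps (fun=> `|x - a|) x); last first.
  by rewrite /walk; field.
by apply: walk_dist_le => //; apply: step; rewrite ?normrN ger0_norm; lra.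
Qed.

(** The successive derivatives of [gabs] up to order 4, in the form that [taylor_le] expects. *)
Let dgabs (k : nat) z : R := match k with
  | 0 => gabs z
  | 1 => gtail (- z) - gtail z
  | 2 => 2 * gd z
  | 3 => - 2 * z * gd z
  | _ => 2 * (z ^+ 2 - 1) * gd z
  end.

(** The constant 6 bounds the fourth derivative, by [z ^+ 2 * gd z <= 2] and [gd z <= 1]. *)
Lemma gabs_taylor z h : `|gabs (z + h) - (gabs z +
    (gtail (- z) - gtail z) * h + gd z * h ^+ 2 - z * gd z * h ^+ 3 / 3)|
  <= 6 * `|h| ^+ 4.
Proof.
have dA k (t : R) : (k < 4)%N -> 0 <= t <= 1 ->
    is_derive (z + t * h) 1 (dgabs k) (dgabs k.+1 (z + t * h)).
  case: k => [|[|[|[|//]]]] _ _ /=.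
  - exact: is_derive_gabs.
  - exact: is_derive_gabs1.
  - exact: is_derive_gabs2.
  - exact: is_derive_gabs3.
have dB (t : R) : 0 <= t <= 1 -> `|dgabs 4 (z + t * h)| <= 6.
  move=> _; rewrite /dgabs; set y := z + _.
  have := sqr_gd_le y; have := gd_le1 y; have := gd_ge0 y; have := sqr_ge0 y.
  by rewrite ler_norml; move: (gd y) => g ? ? ? ?; apply/andP; split; nra.
have := taylor_le dA dB.
rewrite !big_ord_recl big_ord0 /= /bump /= !factS fact0.
congr (`|_ - _| <= _).
by field.
Qed.

(** A step has mean 0, variance 1 - eps^2 and third moment -2 eps (1 - eps^2). In a cubic expansion
    the linear term averages out, the quadratic one gives the main term, the skewness gives the
    error in [eps / s ^+ 2], and the remainder gives 96 = 6 * 2^4. *)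
Lemma walk_gabs_space eps a x s : 0 <= eps -> eps <= 1 -> 0 < s ->
  `|walk eps (fun y => s * gabs ((a - y) / s)) x -
    (s * gabs ((a - x) / s) + (1 - eps ^+ 2) * gd ((a - x) / s) / s)| <=
  96 / s ^+ 3 + 2 * eps / s ^+ 2.
Proof.
move=> e0 e1 s0; set z := (a - x) / s.
have sN0 : s != 0 by rewrite gt_eqF.
(* [s] times the cubic Taylor polynomial of [gabs] at [z] for the increment [- h / s]. *)
pose T h := s * gabs z - (gtail (- z) - gtail z) * h + gd z * h ^+ 2 / s +
  z * gd z * h ^+ 3 / (3 * s ^+ 2).
have step h : `|h| <= 2 -> `|s * gabs ((a - (x + h)) / s) - T h| <= 96 / s ^+ 3.
  move=> h2; have := gabs_taylor z (- h / s).
  have -> : z + - h / s = (a - (x + h)) / s by rewrite /z; field.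
  move/(ler_wpM2l (ltW s0)); rewrite -{1}(gtr0_norm s0) -normrM.
  have -> : s * (gabs ((a - (x + h)) / s) - (gabs z +
     (gtail (- z) - gtail z) * (- h / s) + gd z * (- h / s) ^+ 2 -
     z * gd z * (- h / s) ^+ 3 / 3)) = s * gabs ((a - (x + h)) / s) - T h.
    by rewrite /T; field.
  move/le_trans; apply.
  rewrite normrM normrN normfV (gtr0_norm s0) exprMn.
  have -> : s * (6 * (`|h| ^+ 4 * s^-1 ^+ 4)) = 6 * `|h| ^+ 4 / s ^+ 3 by field.
  rewrite ler_pM2r ?invr_gt0 ?exprn_gt0//.
  have : `|h| ^+ 4 <= 2 ^+ 4 by rewrite lerXn2r ?nnegrE.
  by lra.
have s1 : `|1 - eps| <= 2 by rewrite ger0_norm; lra.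
have s2 : `|- (1 + eps)| <= 2 by rewrite normrN ger0_norm; lra.
have Z : 0 <= 96 / s ^+ 3 by rewrite divr_ge0// exprn_ge0// ltW.
have d1 : `|walk eps (fun y => s * gabs ((a - y) / s)) x -
    walk eps (fun y => T (y - x)) x| <= 96 / s ^+ 3.
  apply: walk_dist_le => //.
    by have := step _ s1; congr (`|_ - T _| <= _); ring.
  by have := step _ s2; congr (`|_ - T _| <= _); ring.
(* The last summand undoes the average of the cubic term of [T]. *)
have -> : s * gabs z + (1 - eps ^+ 2) * gd z / s =
    walk eps (fun y => T (y - x)) x +
    z * gd z * (2 * eps * (1 - eps ^+ 2) / (3 * s ^+ 2)).
  by rewrite /walk /T; field.
rewrite opprD addrA (le_trans (ler_normB _ _))// lerD//.
have q0 : 0 <= 1 - eps ^+ 2 <= 1.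
  by rewrite subr_ge0 gerBl sqr_ge0 andbT exprn_ile1.
rewrite normrM; have zg := norm_gd_le z.
have -> : 2 * eps * (1 - eps ^+ 2) / (3 * s ^+ 2) =
   (2 / 3 * eps * (1 - eps ^+ 2)) / s ^+ 2 by field.
rewrite [X in _ * X]normrM (ger0_norm (_ : 0 <= (s ^+ 2)^-1)) ?invr_ge0 ?sqr_ge0//.
rewrite mulrA ler_pM2r ?invr_gt0 ?exprn_gt0//.
rewrite [X in _ * X]ger0_norm; last by case/andP: q0 => q0 _; by rewrite !(mulr_ge0, divr_ge0).
move: q0 zg => /andP[]; move: (1 - _) (`|_|) (normr_ge0 (z * gd z)) => q Y Y0 q0 q1 Y2.
have : eps * q <= eps by rewrite ler_piMr.
have : 0 <= eps * q by rewrite mulr_ge0.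
move=> q2 q3; have YQ : Y * (eps * q) <= 2 * eps by apply: ler_pM.
rewrite (_ : _ * _ = 2 / 3 * (Y * (eps * q))); last by ring.
by lra.
Qed.

(** First-order expansion in the standard deviation: y -> y gabs(w / y) has derivative 2 gd(w / y).
    With h = s' - s one has k = 2 s h + h^2, so k gd / s differs from 2 h gd by h^2 gd / s; as h <=
    1 / s, the two errors are 4 / s^3 and 1 / s^3. For k = 1 - eps^2 the main term is that of
    [walk_gabs_space]. *)
Lemma gabs_time w s s' k : 0 < s -> 0 < s' -> s' ^+ 2 = s ^+ 2 + k ->
  0 <= k -> k <= 1 ->
  `|s' * gabs (w / s') - (s * gabs (w / s) + k * gd (w / s) / s)| <= 5 / s ^+ 3.
Proof.
move=> s0 s'0 s's k0 k1.
have ss' : s <= s'.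
  have : s ^+ 2 <= s' ^+ 2 by rewrite s's lerDl.
  by rewrite ler_pXn2r// nnegrE ltW.
pose m (i : nat) (y : R) := match i with
  | 0 => y * gabs (w / y)
  | 1 => 2 * gd (w / y)
  | _ => 2 * ((w / y) ^+ 2 * gd (w / y)) / y
  end.
have path0 (t : R) : 0 <= t <= 1 -> s <= s + t * (s' - s).
  by case/andP=> t0 _; rewrite lerDl mulr_ge0// subr_ge0.
have dV (y : R) : 0 < y -> is_derive y 1 (fun y => w / y) (- w / y ^+ 2).
  move=> y0; have yN0 : y != 0 by rewrite gt_eqF.
  have := derZ w (is_deriveV (f := fun y => y) yN0 (der_id y)).
  move/der_eq; apply; rewrite /GRing.scale/=; field; exact: yN0.
have dm i (t : R) : (i < 2)%N -> 0 <= t <= 1 ->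
    is_derive (s + t * (s' - s)) 1 (m i) (m i.+1 (s + t * (s' - s))).
  move=> i2 /path0; move: (s + _) => y sy.
  have y0 : 0 < y by exact: lt_le_trans sy.
  have yN0 : y != 0 by rewrite gt_eqF.
  case: i i2 => [|[|//]] _ /=.
    have := derM (der_id y) (@der_comp R _ _ y _ _ (is_derive_gabs (w / y)) (dV y y0)).
    by move/der_eq; apply; rewrite /gabs; field; exact: yN0.
  have := @der_comp R _ _ y _ _ (is_derive_gabs2 (w / y)) (dV y y0).
  by move/der_eq; apply; field; exact: yN0.
have mb (t : R) : 0 <= t <= 1 -> `|m 2 (s + t * (s' - s))| <= 4 / s.
  move=> /path0; move: (s + _) => y sy.
  have y0 : 0 < y by exact: lt_le_trans sy.
  rewrite /m ger0_norm; last first.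
    by rewrite !(sqr_ge0, gd_ge0, mulr_ge0, invr_ge0)// ltW.
  apply: ler_pM; rewrite ?invr_ge0 ?(ltW y0)//.
  - by rewrite !(sqr_ge0, gd_ge0, mulr_ge0).
  - by have := sqr_gd_le (w / y); lra.
  - by rewrite lef_pV2// posrE.
have sN0 : s != 0 by rewrite gt_eqF.
have := taylor_le dm mb.
rewrite !big_ord_recl big_ord0 /= /bump /= !factS fact0 [s + (s' - s)]addrC subrK.
set h := s' - s; set G := gd (w / s).
have h0 : 0 <= h by rewrite subr_ge0.
have hk : h * (s' + s) = k by rewrite /h -subr_sqr s's addrAC subrr add0r.
have hs : h * s <= 1 by nra.
have h2 : h ^+ 2 <= 1 / s ^+ 2.
  by rewrite ler_pdivlMr ?exprn_gt0// -exprMn exprn_ile1// mulr_ge0// ltW.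
have kE : k * G / s = 2 * G * h + G * h ^+ 2 / s.
  have s'E : s' = s + h by rewrite /h addrC subrK.
  by rewrite -hk s'E; field.
rewrite (ger0_norm h0) kE => ht.
have -> : 5 / s ^+ 3 = 4 / s * (1 / s ^+ 2) + 1 / s * (1 / s ^+ 2) by field.
set B := s * _; rewrite [X in `|X|](_ : _ = s' * gabs (w / s') -
   (B + 2 * G * h) - G * h ^+ 2 / s); last by ring.
rewrite (le_trans (ler_normB _ _))// lerD//.
  apply: (le_trans _ (ler_wpM2l _ h2)); last by rewrite divr_ge0// ltW.
  apply: (le_trans _ ht); rewrite le_eqVlt; apply/orP; left; apply/eqP.
  by congr (`|_ - _|); rewrite /B -/G; field.
rewrite ger0_norm; last by rewrite !(sqr_ge0, gd_ge0, mulr_ge0, invr_ge0)// ltW.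
rewrite mulrAC; apply: ler_pM; rewrite ?mulr_ge0 ?gd_ge0 ?invr_ge0 ?sqr_ge0 ?(ltW s0)//.
by rewrite ler_pM2r ?invr_gt0// gd_le1.
Qed.

End CentralLimit.

(** * Central limit bound for |. - a| with error O(1 + eps^2 n) *)

Section CentralLimitBound.
Context {R : realType}.
Implicit Types (eps a x y : R) (n : nat).

Let r n : R := Num.sqrt n%:R.
(** Standard deviation of the walk after [n] steps. *)
Let sd eps n : R := Num.sqrt ((1 - eps ^+ 2) * n%:R).

Let r_gt0 n : 0 < r n.+1.
Proof. by rewrite sqrtr_gt0 ltr0n. Qed.

Let r_sqr n : r n ^+ 2 = n%:R.
Proof. by rewrite sqr_sqrtr. Qed.

(** Makes the sum of n^(-3/2) telescope. For the two roots a and b, b^2 - a^2 = 1 gives 1/a - 1/b =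
    1 / (a b (a + b)), and b <= 2 a. *)
Let sqrt_inv_cube_le n :
  1 / r n.+1 ^+ 3 <= 6 * (1 / r n.+1 - 1 / r n.+2).
Proof.
have := r_gt0 n; have := r_gt0 n.+1; have := r_sqr n.+1; have := r_sqr n.+2.
have : (1 : R) <= n.+1%:R by rewrite ler1n.
move: (r n.+1) (r n.+2) => a b; rewrite -[n.+2%:R]natr1.
move: (n.+1%:R : R) => N N1 b2 a2 b0 a0.
have ab : a <= b by nra.
have b2a : b <= 2 * a by nra.
have aN0 : a != 0 by rewrite gt_eqF.
have bN0 : b != 0 by rewrite gt_eqF.
have -> : 6 * (1 / a - 1 / b) = 6 / (a * b * (a + b)).
  have sN0 : a + b != 0 by rewrite gt_eqF// addr_gt0.
  have e : b ^+ 2 - a ^+ 2 = 1 by rewrite b2 a2; ring.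
  have -> : 6 * (1 / a - 1 / b) = 6 * (b ^+ 2 - a ^+ 2) / (a * b * (a + b)).
    by field; rewrite bN0 sN0 aN0.
  by rewrite e mulr1.
rewrite ler_pdivrMr ?exprn_gt0// mulrAC ler_pdivlMr ?mul1r; last first.
  by rewrite !mulr_gt0// addr_gt0.
have -> : a ^+ 3 = a * a * a by ring.
have ab2 : a * b <= a * (2 * a) by rewrite ler_pM2l.
have : a * b * (a + b) <= a * (2 * a) * (3 * a).
  apply: ler_pM => //; last by lra.
  - by rewrite mulr_ge0 ?ltW.
  - by rewrite addr_ge0 ?ltW.
by lra.
Qed.

(** The walk step and the variance increment have the same main term, which cancels. As eps <= 1/2,
    [r n.+1 <= 2 * s] turns powers of 1 / s into powers of 1 / r; 812 = 8 * 101 + 4. *)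
Let walk_gabs_step eps a x n : 0 < eps -> eps <= 2^-1 ->
  `|walk eps (fun y => sd eps n.+1 * gabs ((a - y) / sd eps n.+1)) x -
    sd eps n.+2 * gabs ((a - x) / sd eps n.+2)| <=
  4 * eps ^+ 2 + 812 * (1 / r n.+1 ^+ 3).
Proof.
move=> e0 e1; set s := sd eps n.+1; set s' := sd eps n.+2.
have k0 : 1 / 4 <= 1 - eps ^+ 2 by nra.
have s0 : 0 < s.
  by rewrite sqrtr_gt0 mulr_gt0// ?ltr0n//; lra.
have s'0 : 0 < s'.
  by rewrite sqrtr_gt0 mulr_gt0// ?ltr0n//; lra.
have ssq : s ^+ 2 = (1 - eps ^+ 2) * n.+1%:R.
  by rewrite sqr_sqrtr// mulr_ge0//; lra.
have s's : s' ^+ 2 = s ^+ 2 + (1 - eps ^+ 2).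
  rewrite ssq sqr_sqrtr; last by (rewrite mulr_ge0//; lra).
  by rewrite -[n.+2%:R]natr1; ring.
have rs : r n.+1 <= 2 * s.
  have : r n.+1 ^+ 2 <= (2 * s) ^+ 2.
    have -> : (2 * s) ^+ 2 = 4 * s ^+ 2 by ring.
    rewrite r_sqr ssq; have : (0 : R) < n.+1%:R by rewrite ltr0n.
    by nra.
  by rewrite ler_pXn2r// nnegrE ?mulr_ge0// ltW.
have r0 := r_gt0 n; have rN0 : r n.+1 != 0 by rewrite gt_eqF.
have cub : 1 / s ^+ 3 <= 8 * (1 / r n.+1 ^+ 3).
  rewrite mul1r mulrA mulr1 ler_pdivlMr ?exprn_gt0// mulrC ler_pdivrMr ?exprn_gt0//.
  have -> : 8 * s ^+ 3 = (2 * s) ^+ 3 by ring.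
  by rewrite lerXn2r// nnegrE ?mulr_ge0// ltW.
have sqr : 1 / s ^+ 2 <= 4 * (1 / r n.+1 ^+ 2).
  rewrite mul1r mulrA mulr1 ler_pdivlMr ?exprn_gt0// mulrC ler_pdivrMr ?exprn_gt0//.
  have -> : 4 * s ^+ 2 = (2 * s) ^+ 2 by ring.
  by rewrite lerXn2r// nnegrE ?mulr_ge0// ltW.
have k1 : 1 - eps ^+ 2 <= 1 by rewrite gerBl sqr_ge0.
have kk : 0 <= 1 - eps ^+ 2 by lra.
have A := @walk_gabs_space R eps a x s (ltW e0) _ s0.
have {}A := A ltac:(lra).
have B := @gabs_time R (a - x) s s' _ s0 s'0 s's kk k1.
have r1 : 1 <= r n.+1 by rewrite -[leLHS]sqrtr1 ler_wsqrtr// ler1n.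
have quart : (1 / r n.+1 ^+ 2) ^+ 2 <= 1 / r n.+1 ^+ 3.
  rewrite expr_div_n expr1n -exprM !mul1r lef_pV2 ?posrE ?exprn_gt0//.
  by rewrite ler_weXn2l.
(* eps / n <= (eps^2 + n^-2) / 2 avoids the logarithm of the harmonic sum. *)
have amgm := sqr_ge0 (eps - 1 / r n.+1 ^+ 2).
rewrite -(subrKA (s * gabs ((a - x) / s) + (1 - eps ^+ 2) * gd ((a - x) / s) / s)).
rewrite (le_trans (ler_normD _ _))//.
rewrite [X in _ + X]distrC.
apply: (le_trans (lerD A B)).
have -> : 96 / s ^+ 3 + 2 * eps / s ^+ 2 + 5 / s ^+ 3 =
  101 * (1 / s ^+ 3) + 2 * eps * (1 / s ^+ 2) by field; rewrite gt_eqF.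
move: cub sqr quart amgm; move: (1 / s ^+ 3) (1 / s ^+ 2) (1 / r n.+1 ^+ 3) (1 / r n.+1 ^+ 2).
by move=> c3 c2 d3 d2 h3 h2 hq; rewrite !expr2 in hq *; nra.
Qed.

(** Induction from one step on, where the variance is positive; that step costs 2 + 2 by the crude
    bounds. The later errors telescope by [sqrt_inv_cube_le], and 4872 = 6 * 812. *)
Let clt_small eps a x n : 0 < eps -> eps <= 2^-1 ->
  `|iter n.+1 (walk eps) (fun y => `|y - a|) x -
    sd eps n.+1 * gabs ((a - x) / sd eps n.+1)| <=
  4 + 4 * eps ^+ 2 * n.+1%:R + 4872 * (1 - 1 / r n.+1).
Proof.
move=> e0 e1; have e1' : eps <= 1 by lra.
have k0 : 1 / 4 <= 1 - eps ^+ 2 by nra.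
elim: n x => [|n IH] x.
  have -> : r 1 = 1 by rewrite /r sqrtr1.
  rewrite divr1 subrr mulr0 addr0 mulr1.
  have s0 : 0 < sd eps 1 by (rewrite sqrtr_gt0 mulr1; lra).
  have s1 : sd eps 1 <= 1.
    by rewrite /sd mulr1 -[leRHS]sqrtr1 ler_wsqrtr// gerBl sqr_ge0.
  have A := @iter_walk_abs_dist R eps 1 a x (ltW e0) e1'.
  have B := gabs_dist (a - x) s0.
  rewrite -(subrKA `|x - a|) (le_trans (ler_normD _ _))//.
  move: A B; rewrite [`|a - x|]distrC [X in _ -> X <= _ -> _]distrC => A B.
  apply: (le_trans (lerD A B)); have := sqr_ge0 eps; lra.
rewrite iterS.
rewrite -(subrKA (walk eps (fun y => sd eps n.+1 * gabs ((a - y) / sd eps n.+1)) x)).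
rewrite (le_trans (ler_normD _ _))//.
have A := walk_gabs_step a x n e0 e1.
have B := walk_dist_le (g := fun y => sd eps n.+1 * gabs ((a - y) / sd eps n.+1))
  (ltW e0) e1' (IH (x + (1 - eps))) (IH (x - (1 + eps))).
apply: (le_trans (lerD B A)).
rewrite [_ * n.+2%:R](_ : _ = 4 * eps ^+ 2 * n.+1%:R + 4 * eps ^+ 2).
  by have := sqrt_inv_cube_le n; lra.
by rewrite -natr1; ring.
Qed.

Lemma walk_abs_clt eps a x n : 0 < eps -> eps < 1 -> (0 < n)%N ->
  `|iter n (walk eps) (fun y => `|y - a|) x -
    Num.sqrt (kappa_of eps * n%:R) *
      gabs ((a - x) / Num.sqrt (kappa_of eps * n%:R))|
  <= 5000 * (1 + eps ^+ 2 * n%:R).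
Proof.
rewrite -/(sd eps n) => e0 e1; case: n => [//|n] _.
(* For eps > 1/2 the crude bounds suffice: 2 n + 2 s <= 4 n <= 16 eps^2 n. *)
have [e2|e2] := leP eps 2^-1.
  apply: (le_trans (clt_small _ _ _ e0 e2)).
  have : 0 <= 1 / r n.+1 by rewrite mul1r invr_ge0 sqrtr_ge0.
  have : 0 <= eps ^+ 2 * n.+1%:R by rewrite mulr_ge0// sqr_ge0.
  by lra.
have k0 : 0 < 1 - eps ^+ 2 by rewrite subr_gt0 exprn_ilt1// ltW.
have k1 : 1 - eps ^+ 2 <= 1 by rewrite gerBl sqr_ge0.
have n1 : (1 : R) <= n.+1%:R by rewrite ler1n.
have s0 : 0 < sd eps n.+1 by rewrite sqrtr_gt0 mulr_gt0// ltr0n.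
have s1 : sd eps n.+1 <= n.+1%:R.
  rewrite /sd -[leRHS]ger0_norm// -sqrtr_sqr ler_wsqrtr// expr2 ler_pM2r ?ltr0n//.
  exact: le_trans n1.
have A := @iter_walk_abs_dist R eps n.+1 a x (ltW e0) (ltW e1).
have B := gabs_dist (a - x) s0.
rewrite -(subrKA `|x - a|) (le_trans (ler_normD _ _))//.
move: A B; rewrite [`|a - x|]distrC [X in _ -> X <= _ -> _]distrC => A B.
apply: (le_trans (lerD A B)).
have : n.+1%:R <= 4 * (eps ^+ 2 * n.+1%:R) by rewrite mulrA ler_peMl//; nra.
by lra.
Qed.

End CentralLimitBound.

(** * Bounds on the exponential; sign of [nu] and lower bound for [rho] *)

Lemma ge0_of_derive_ge0 (R : realType) (h dh : R -> R) (x : R) :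
  h 0 = 0 -> (forall t : R, 0 <= t -> is_derive t 1 h (dh t)) ->
  (forall t : R, 0 <= t -> 0 <= dh t) -> 0 <= x -> 0 <= h x.
Proof.
move=> h0 hdh dh0 x0.
have [||c] := @MVT_segment R h dh 0 x x0.
- by move=> t; rewrite in_itv/= => /andP[/ltW t0 _]; exact: hdh.
- apply: derivable_within_continuous => t; rewrite in_itv/= => /andP[t0 _].
  by have := hdh t t0; case.
- rewrite in_itv/= h0 !subr0 => /andP[c0 _] ->.
  by rewrite mulr_ge0// dh0.
Qed.

Section LocalErrors.
Context {R : realType}.
Implicit Types (eps x : R).

Lemma kappa_gt0 eps : 0 < eps -> eps < 1 -> 0 < kappa_of eps.
Proof. by move=> e0 e1; rewrite subr_gt0 exprn_ilt1// ltW. Qed.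

Let expR_ge_quadratic x : 0 <= x -> 1 + x + x ^+ 2 / 2 <= expR x.
Proof.
move=> x0; rewrite -subr_ge0.
apply: (@ge0_of_derive_ge0 R (fun t => expR t - (1 + t + t ^+ 2 / 2))
   (fun t => expR t - (1 + t))) x0 => [|t _|t _].
- by rewrite expR0 expr0n/= mul0r !addr0 subrr.
- have := derM (derX 2 (der_id t)) (der_cst (2^-1) t).
  move/(derD (derD (der_cst 1 t) (der_id t)))/(derB (is_derive_expR t)).
  by move/der_eq; apply; field.
- by rewrite subr_ge0 expR_ge1Dx.
Qed.

Let is_derive_expRN x : is_derive x 1 (fun t => expR (- t)) (- expR (- x)).
Proof.
have := @der_comp R _ _ x _ _ (is_derive_expR (- x)) (is_deriveNid x 1).
by rewrite mulrN1.
Qed.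

(** Taylor truncations of [expR (- x)] are alternately upper and lower bounds: differentiating each
    inequality gives the previous one. *)
Let expRN_ge_cubic x : 0 <= x ->
  1 - x + x ^+ 2 / 2 - x ^+ 3 / 6 <= expR (- x).
Proof.
have quad (t : R) : 0 <= t -> 0 <= 1 - t + t ^+ 2 / 2 - expR (- t).
  apply: (@ge0_of_derive_ge0 R (fun t => 1 - t + t ^+ 2 / 2 - expR (- t))
     (fun t => expR (- t) - (1 - t))) => [|{}t _|{}t _].
  - by rewrite oppr0 expR0 expr0n/= mul0r !addr0 subrr.
  - have := derM (derX 2 (der_id t)) (der_cst (2^-1) t).
    move/(derD (derB (der_cst 1 t) (der_id t))).
    move/(fun H => derB H (is_derive_expRN t)).
    by move/der_eq; apply; field.
  - by rewrite subr_ge0 expR_ge1Dx.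
move=> x0; rewrite -subr_ge0.
apply: (@ge0_of_derive_ge0 R (fun t => expR (- t) - (1 - t + t ^+ 2 / 2 - t ^+ 3 / 6))
   (fun t => 1 - t + t ^+ 2 / 2 - expR (- t))) x0 => [|t _|t t0].
- by rewrite oppr0 expR0 !expr0n/= !mul0r !addr0 !subr0 subrr.
- have := derM (derX 2 (der_id t)) (der_cst (2^-1) t).
  move/(derD (derB (der_cst 1 t) (der_id t))).
  move/(fun H => derB H (derM (derX 3 (der_id t)) (der_cst (6^-1) t))).
  move/(derB (is_derive_expRN t)).
  by move/der_eq; apply; field.
- exact: quad.
Qed.

(** A Pade bound, for the range eps > 1/2 where 2 eps / kappa may be large and the cubic truncation
    is poor. *)
Let expRN_ge_pade x : 0 <= x -> 2 - x <= (2 + x) * expR (- x).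
Proof.
move=> x0; rewrite -subr_ge0.
apply: (@ge0_of_derive_ge0 R (fun t => (2 + t) * expR (- t) - (2 - t))
   (fun t => 1 - (1 + t) * expR (- t))) x0 => [|t _|t t0].
- by rewrite oppr0 expR0 mulr1 addr0 subrr.
- have := derM (derD (der_cst 2 t) (der_id t)) (is_derive_expRN t).
  move/(fun H => derB H (derB (der_cst 2 t) (der_id t))).
  by move/der_eq; apply; ring.
- by rewrite subr_ge0 expRN ler_pdivrMr ?expR_gt0// mul1r expR_ge1Dx.
Qed.

(** With E = expR c, nu = (E - 1) ((1 - eps) E - (1 + eps)) / (2 E); the quadratic lower bound on E
    makes the second factor nonnegative. *)
Lemma nu_ge0 eps : 0 < eps -> eps < 1 -> 0 <= nu eps.
Proof.
move=> e0 e1; have k0 := kappa_gt0 e0 e1; rewrite /nu.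
have kE : kappa_of eps = (1 - eps) * (1 + eps) by rewrite /kappa_of; ring.
have k1 : kappa_of eps <= 1 by rewrite gerBl sqr_ge0.
have kN0 : kappa_of eps != 0 by rewrite gt_eqF.
set c := 2 * eps / kappa_of eps.
have c0 : 0 <= c by rewrite divr_ge0 ?mulr_ge0 ?ltW.
have -> : - 2 * eps / kappa_of eps = - c by rewrite /c; field.
rewrite expRN; have := expR_ge_quadratic c0; have := expR_gt0 c.
set E := expR c => E0 Ege.
have : (1 + eps) <= (1 - eps) * E.
  apply: (le_trans _ (ler_wpM2l _ Ege)); last by lra.
  have -> : (1 - eps) * (1 + c + c ^+ 2 / 2) =
      1 + eps + 2 * eps ^+ 2 / kappa_of eps * ((1 - eps) / kappa_of eps - (1 - eps)).
    by rewrite /c; rewrite kE; field; rewrite !gt_eqF//; lra.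
  rewrite lerDl mulr_ge0//.
    by rewrite divr_ge0 ?mulr_ge0 ?sqr_ge0 ?ltW.
  by rewrite subr_ge0 ler_pdivlMr// ler_piMr//; lra.
move=> E1; have -> : E^-1 * ((1 + eps) / 2) + E * ((1 - eps) / 2) - 1 =
   (E - 1) * ((1 - eps) * E - (1 + eps)) / (2 * E) by field; rewrite gt_eqF.
rewrite divr_ge0//; last by lra.
by apply: mulr_ge0; [nra|lra].
Qed.

(** The right side increases with expR(-c), so lower bounds of the exponential suffice: the cubic
    one for eps <= 1/2, where 1/3 - eps^2 >= 1/12 gives the constant, and beyond it the Pade one,
    which yields eps^3 / (1 + eps - eps^2). *)
Lemma rho_ge eps : 0 < eps -> eps < 1 ->
  eps ^+ 2 / 12 <= kappa_of eps / eps * rho eps + 1.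
Proof.
move=> e0 e1; have k0 := kappa_gt0 e0 e1; rewrite /rho.
have kN0 : kappa_of eps != 0 by rewrite gt_eqF.
have k1 : kappa_of eps <= 1 by rewrite gerBl sqr_ge0.
have eN0 : eps != 0 by rewrite gt_eqF.
set c := 2 * eps / kappa_of eps.
have c0 : 0 < c by rewrite divr_gt0 ?mulr_gt0.
have cN0 : c != 0 by rewrite gt_eqF.
have -> : - 2 * eps / kappa_of eps = - c by rewrite /c; field.
have bE : kappa_of eps / eps = 2 / c.
  by rewrite /c; field; rewrite eN0 kN0.
set E := expR (- c).
have lower y : y <= E -> 1 - (1 + eps) / c * (1 - y) <=
    kappa_of eps / eps * ((E - 1) * ((1 + eps) / 2)) + 1.
  move=> yE; rewrite bE.
  have : 0 <= (1 + eps) / c by rewrite divr_ge0 ?ltW//; lra.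
  have -> : 2 / c * ((E - 1) * ((1 + eps) / 2)) + 1 =
    1 - (1 + eps) / c * (1 - E) by field.
  by move=> ?; rewrite lerD2l lerN2 ler_wpM2l// lerD2l lerN2.
have [e2|e2] := leP eps 2^-1.
  apply: (le_trans _ (lower _ (expRN_ge_cubic (ltW c0)))).
  have -> : 1 - (1 + eps) / c * (1 - (1 - c + c ^+ 2 / 2 - c ^+ 3 / 6)) =
     eps ^+ 2 * ((1 + eps) * (3^-1 - eps ^+ 2)) / kappa_of eps ^+ 2.
    by rewrite /c; move: kN0; rewrite /kappa_of => kN0; field; rewrite kN0 eN0.
  rewrite ler_pdivlMr ?exprn_gt0// -mulrA ler_wpM2l ?sqr_ge0//.
  have : kappa_of eps ^+ 2 <= 1 by rewrite exprn_ile1// ltW.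
  have : 12^-1 <= (1 + eps) * (3^-1 - eps ^+ 2) by nra.
  lra.
have := expRN_ge_pade (ltW c0); rewrite -ler_pdivrMl; last by lra.
move/lower; apply: le_trans.
have d0 : 0 < 1 + eps - eps ^+ 2 by nra.
have -> : 1 - (1 + eps) / c * (1 - (2 + c)^-1 * (2 - c)) =
   eps ^+ 3 / (1 + eps - eps ^+ 2).
  rewrite /c; move: kN0 d0; rewrite /kappa_of => kN0 d0.
  by field; rewrite kN0 eN0 gt_eqF//= gt_eqF//; nra.
rewrite ler_pdivlMr// [eps ^+ 3]exprSr -mulrA ler_wpM2l ?sqr_ge0//.
by nra.
Qed.

End LocalErrors.

(** * The value function as a walk expectation, up to local errors *)

Section BanditValue.
Context {R : realType}.
Implicit Types (eps eta t x y p : R) (xi : R * R) (n : nat) (k : int).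

(** For this [b] the slope at 0 is -1 on both sides, so the function is C^1. *)
Definition phi_c1 eps y : R :=
  phi eps (kappa_of eps) (kappa_of eps / eps) y.

Definition local_error eps : R :=
  kappa_of eps / eps * nu eps + kappa_of eps / eps * rho eps + 1.

Lemma local_error_ge eps : 0 < eps -> eps < 1 ->
  eps ^+ 2 / 12 <= local_error eps.
Proof.
move=> e0 e1; rewrite /local_error -addrA (le_trans (rho_ge e0 e1))// lerDr.
by rewrite mulr_ge0 ?nu_ge0// divr_ge0 ?ltW// kappa_gt0.
Qed.

Let phi_c1_le0 eps y : y <= 0 -> phi_c1 eps y = - y.
Proof. by rewrite /phi_c1 /phi => ->. Qed.

Let phi_c1_ge0 eps y : 0 <= y -> phi_c1 eps y =
  y + kappa_of eps / eps * expR (- 2 * eps / kappa_of eps * y) - kappa_of eps / eps.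
Proof.
move=> y0; rewrite /phi_c1 /phi; case: ifPn => [yle|_].
  have -> : y = 0 by apply/eqP; rewrite eq_le yle y0.
  by rewrite mulr0 expR0; ring.
by rewrite [- 2 * eps * y / _]mulrAC.
Qed.

(** In the coordinate k = xi^r + eps t a step is +1 or -1, so an integer k never jumps over 0. For k
    < 0 the function is linear and the defect vanishes; for k > 0 the exponential gets multiplied by
    1 + nu; at k = 0 the two branches meet and give b rho + 1. *)
Lemma phi_c1_step eps xi t k : 0 < eps -> eps < 1 ->
  xi.2 + eps * t = k%:~R ->
  `|(1 + eps) / 2 * phi_c1 eps (k%:~R + 1) +
    (1 - eps) / 2 * phi_c1 eps (k%:~R - 1) - phi_c1 eps k%:~R -
    eps * (2 * myopic1 eps xi t - 1)| <= local_error eps.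
Proof.
move=> e0 e1 xk; rewrite /myopic1 xk.
have b0 : 0 < kappa_of eps / eps by rewrite divr_gt0// kappa_gt0.
have bnu : 0 <= kappa_of eps / eps * nu eps.
  by rewrite mulr_ge0 ?nu_ge0// ltW.
have brho : 0 <= kappa_of eps / eps * rho eps + 1.
  by apply: le_trans (rho_ge e0 e1); rewrite divr_ge0// sqr_ge0.
have [k0|k0|k0] := ltgtP k 0.
- have k1 : k%:~R + 1 <= 0 :> R by rewrite -[1]/(1%:~R) -intrD lerz0 lezD1.
  rewrite ltr0z ltNge (ltW k0)/= intr_eq0 lt_eqF//.
  rewrite !phi_c1_le0; [|lra..].
  rewrite (_ : _ - _ = 0); last by field.
  by rewrite normr0 /local_error; lra.
- have k1 : 0 <= k%:~R - 1 :> R by rewrite subr_ge0 ler1z -gtz0_ge1.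
  rewrite ltr0z k0 /= !phi_c1_ge0; [|lra..].
  rewrite !mulrDr mulr1 mulrN1 !expRD.
  set c := - 2 * eps / kappa_of eps.
  set B := kappa_of eps / eps; set E := expR (c * _).
  rewrite (_ : _ - _ = E * (B * nu eps)); last first.
    have cN : 2 * eps / kappa_of eps = - c by rewrite /c !mulNr opprK.
    by rewrite /nu -/c cN !mulr1 !mulrN1; field.
  rewrite ger0_norm; last by rewrite mulr_ge0 ?expR_ge0.
  rewrite (@le_trans _ _ (B * nu eps))// ?ler_piMl//.
    rewrite expR_le1 nmulr_rle0; first by lra.
    by rewrite /c !mulNr oppr_lt0 divr_gt0 ?mulr_gt0// kappa_gt0.
  by rewrite /local_error -addrA lerDl.
- rewrite k0 ltxx eqxx sub0r add0r.
  rewrite [phi_c1 eps 0]phi_c1_le0// [phi_c1 eps (-1)]phi_c1_le0; last by lra.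
  rewrite phi_c1_ge0// mulr1.
  rewrite (_ : _ - _ = kappa_of eps / eps * rho eps + 1); last first.
    rewrite /rho; move: (expR _) => E.
    rewrite /kappa_of; field; rewrite gt_eqF//.
  by rewrite ger0_norm// /local_error -addrA lerDr.
Qed.

Let expectE eps xi t (X : bool -> bool -> bool -> R) : expect eps xi t X =
  (1 + eps) / 2 * ((1 - eps) / 2) *
    (myopic1 eps xi t * X true true true +
     (1 - myopic1 eps xi t) * X true true false) +
  (1 + eps) / 2 * (1 - (1 - eps) / 2) *
    (myopic1 eps xi t * X true false true +
     (1 - myopic1 eps xi t) * X true false false) +
  (1 - (1 + eps) / 2) * ((1 - eps) / 2) *
    (myopic1 eps xi t * X false true true +
     (1 - myopic1 eps xi t) * X false true false) +
  (1 - (1 + eps) / 2) * (1 - (1 - eps) / 2) *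
    (myopic1 eps xi t * X false false true +
     (1 - myopic1 eps xi t) * X false false false).
Proof. by rewrite /expect !big_bool /bernoulli_pmf /=; field. Qed.

Let myopic1_01 eps xi t : 0 <= myopic1 eps xi t <= 1.
Proof. by rewrite /myopic1; case: ifP => _; [|case: ifP => _]; lra. Qed.

Lemma expect_dist_le eps xi t (X Y : bool -> bool -> bool -> R) (D : R) :
  0 <= eps -> eps <= 1 ->
  (forall g1 g2 I, `|X g1 g2 I - Y g1 g2 I| <= D) ->
  `|expect eps xi t X - expect eps xi t Y| <= D.
Proof.
move=> e0 e1 XY; rewrite /expect -sumrB.
have /andP[p0 p1] := myopic1_01 eps xi t.
have bp (p : R) b : 0 <= p -> p <= 1 -> 0 <= bernoulli_pmf p b.
  by move=> ? ?; rewrite bernoulli_pmf_ge0//; apply/andP.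
have -> : D = \sum_(g1 : bool) \sum_(g2 : bool) \sum_(I : bool)
    bernoulli_pmf ((1 + eps) / 2) g1 * bernoulli_pmf ((1 - eps) / 2) g2 *
    bernoulli_pmf (myopic1 eps xi t) I * D.
  by rewrite !big_bool /bernoulli_pmf /=; field.
rewrite (le_trans (ler_norm_sum _ _ _))//; apply: ler_sum => g1 _.
rewrite -sumrB (le_trans (ler_norm_sum _ _ _))//; apply: ler_sum => g2 _.
rewrite -sumrB (le_trans (ler_norm_sum _ _ _))//; apply: ler_sum => I _.
rewrite -mulrBr normrM ger0_norm ?ler_wpM2l//.
- by rewrite !mulr_ge0// bp//; lra.
- by rewrite !mulr_ge0// bp//; lra.
Qed.

Let move_xi eps (up : bool) x : R :=
  if up then x + (1 - eps) else x - (1 + eps).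

(** Whichever arm is pulled, xi^h + xi^r gains g1 - g2 - 2 eps, which is two walk steps, hence
    [n.*2]; xi^r makes one step, as g1 and -g2 have the same law. Half the mean of [deta] is - eps
    (2 p - 1), with p the probability of arm 1, and the drift of [phi_c1] offsets it up to the
    defect of [phi_c1_step]. *)
Lemma value_to_go_dist eps n eta xi k : 0 < eps -> eps < 1 ->
  xi.2 - eps * n%:R = k%:~R ->
  `|value_to_go eps n eta xi -
    (2^-1 * (eta + iter n.*2 (walk eps) (fun y => `|y - 0|) (xi.2 + xi.1)) +
     (phi_c1 eps k%:~R - iter n (walk eps) (phi_c1 eps) xi.2))| <=
  n%:R * local_error eps.
Proof.
move=> e0 e1; elim: n eta xi k => [|n IH] eta xi k xk.
  by rewrite /= -xk mulr0 !subr0 subrr addr0 /mu subrr mul0r normr0.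
pose W := iter n.*2 (walk eps) (fun y => `|y - 0|).
pose P := iter n (walk eps) (phi_c1 eps).
pose t : R := - n.+1%:R.
(* The approximation with [n] steps to go, evaluated after one outcome of the round. *)
pose V g1 g2 I := 2^-1 * (eta + deta g1 g2 I +
  W (move_xi eps g1 (move_xi eps (~~ g2) (xi.2 + xi.1)))) +
  ((if (if I then g1 else ~~ g2) then phi_c1 eps (k%:~R + 1)
    else phi_c1 eps (k%:~R - 1)) -
   P (move_xi eps (if I then g1 else ~~ g2) xi.2)).
rewrite /value_to_go -/value_to_go -/t.
(* The induction hypothesis handles each outcome; averaging [V] over the round then leaves exactly
   the one-step defect. *)
rewrite -(subrKA (expect eps xi t V)) (le_trans (ler_normD _ _))//.
rewrite -[n.+1%:R]natr1 mulrDl mul1r lerD//.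
  apply: expect_dist_le => [||g1 g2 I]; [exact: ltW|exact: ltW|].
  pose up := if I then g1 else ~~ g2.
  have d2 : (xi + dxi eps g1 g2 I).2 = move_xi eps up xi.2.
    rewrite /= /up /dxi /move_xi /reward.
    by clear up; case: I; case: g1; case: g2 => /=; ring.
  have kE : (xi + dxi eps g1 g2 I).2 - eps * n%:R =
      (if up then k + 1 else k - 1)%:~R.
    have -> : (if up then k + 1 else k - 1)%:~R =
       (if up then k%:~R + 1 else k%:~R - 1) :> R.
      by clear d2; case: up; rewrite ?intrD// intrB.
    by rewrite d2 -xk /move_xi -natr1; clear d2; case: up; ring.
  have := IH (eta + deta g1 g2 I) _ _ kE.
  have -> : (xi + dxi eps g1 g2 I).2 + (xi + dxi eps g1 g2 I).1 =
      move_xi eps g1 (move_xi eps (~~ g2) (xi.2 + xi.1)).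
    rewrite /= /dxi /move_xi /reward.
    by clear up d2 kE; case: I; case: g1; case: g2 => /=; ring.
  rewrite d2 /V -/up; congr (`|_ - (_ + (_ - _))| <= _).
  by clear d2 kE; case: up; rewrite ?intrD// intrB.
have xt : xi.2 + eps * t = k%:~R by rewrite -xk /t mulrN.
have := phi_c1_step e0 e1 xt; congr (`|_| <= _).
rewrite doubleS !iterS -/W -/P expectE /V /deta /reward /= /walk.
by field.
Qed.

End BanditValue.

(** * Geometric mixtures of |. - i| and the central limit bound for [phi_c1] *)

Section PhiMixture.
Context {R : realType}.
Implicit Types (eps q x y s : R) (M n : nat).

(* Weights of a geometric distribution truncated at M, where the whole tail is
   placed. *)
Definition tgeom q M (i : nat) : R := if (i < M)%N then (1 - q) * q ^+ i else q ^+ M.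

Definition abs_mixture q M y : R :=
  \sum_(i < M.+1) tgeom q M i * `|y - i%:R|.

Lemma tgeom_ge0 q M i : 0 <= q -> q <= 1 -> 0 <= tgeom q M i.
Proof.
by move=> q0 q1; rewrite /tgeom; case: ifP => _; rewrite ?mulr_ge0 ?exprn_ge0 ?subr_ge0.
Qed.

Lemma sum_tgeom q M : \sum_(i < M.+1) tgeom q M i = 1.
Proof.
rewrite big_ord_recr /= {2}/tgeom ltnn.
under eq_bigr do rewrite /tgeom ltn_ord.
rewrite -mulr_sumr -opprB mulNr -subrX1 opprB.
by rewrite subrK.
Qed.

(* Conditioning on the first trial of the geometric distribution. *)
Lemma abs_mixtureS q M y :
  abs_mixture q M.+1 y = (1 - q) * `|y| + q * abs_mixture q M (y - 1).
Proof.
rewrite /abs_mixture big_ord_recl {1}/tgeom /= expr0 mulr1 subr0; congr (_ + _).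
rewrite mulr_sumr; apply: eq_bigr => i _; rewrite /tgeom /bump /= add1n ltnS.
rewrite -natr1 opprD addrA [y - _ - _]addrAC.
by case: ifP => _; rewrite exprS; ring.
Qed.

Section fixed_eps.
Variable eps : R.
Hypotheses (e0 : 0 < eps) (e1 : eps < 1).

Let c : R := 2 * eps / kappa_of eps.
Let q : R := expR (- c).
(** Mean of the geometric law with weights (1 - q) q^i; adding it makes [F y] the exact mean of |y -
    i| for y <= 0. *)
Let K : R := q / (1 - q).
Let F y : R := phi_c1 eps y + K.

Let c_gt0 : 0 < c.
Proof. by rewrite divr_gt0 ?mulr_gt0// kappa_gt0. Qed.

Let c2_gt0 : 0 < 2 / c.
Proof. by have := c_gt0; move: c => d d0; rewrite divr_gt0. Qed.

Let q_gt0 : 0 < q. Proof. exact: expR_gt0. Qed.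

Let q_lt1 : q < 1. Proof. by rewrite expR_lt1 oppr_lt0. Qed.

Let K_ge0 : 0 <= K.
Proof. by rewrite divr_ge0 ?ltW// subr_gt0. Qed.

Let kN0 : kappa_of eps != 0.
Proof. by rewrite gt_eqF// kappa_gt0. Qed.

Let eN0 : eps != 0.
Proof. by rewrite gt_eqF. Qed.

Let phi_le0 y : y <= 0 -> phi_c1 eps y = - y.
Proof. by rewrite /phi_c1 /phi => ->. Qed.

Let phi_ge0 y : 0 <= y -> phi_c1 eps y = y + 2 / c * (expR (- (c * y)) - 1).
Proof.
move=> y0; have bE : kappa_of eps / eps = 2 / c.
  by rewrite /c; field; rewrite eN0 kN0.
rewrite /phi_c1 /phi bE; case: ifPn => [yle|_].
  have -> : y = 0 by apply/eqP; rewrite eq_le yle y0.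
  by rewrite mulr0 oppr0 expR0; ring.
rewrite (_ : - 2 * eps * y / _ = - (c * y)); first by ring.
by rewrite /c; field.
Qed.

Let expRN_le y : 0 <= y -> expR (- y) * (1 + y) <= 1.
Proof.
move=> y0; rewrite expRN mulrC ler_pdivrMr ?expR_gt0// mul1r.
exact: expR_ge1Dx.
Qed.

(** [F] almost satisfies the recursion of [abs_mixtureS]: exactly for y <= 0; for y >= 1 the
    exponentials cancel because q expR(c) = 1, leaving 2 q - 2 (1 - q) / c with q <= (1 - q) / c <=
    1. In between, 1 - c y <= expR(- c y) <= 1 / (1 + c y) suffices. The factor 1 - q keeps the
    accumulated defect bounded uniformly in [eps]. *)
Let mixture_defect y :
  - 2 * (1 - q) <= F y - ((1 - q) * `|y| + q * F (y - 1)) <= 0.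
Proof.
have q1N0 : 1 - q != 0 by rewrite gt_eqF// subr_gt0.
have cN0 : c != 0 by rewrite gt_eqF.
have KE : K * (1 - q) = q by rewrite /K divfK.
have qc := expRN_le (ltW c_gt0); rewrite -/q in qc.
have qge : 1 - c <= q := expR_ge1Dx (- c).
have [y0|y0] := leP y 0.
  have y1 : y - 1 <= 0 by lra.
  rewrite /F !phi_le0// ler0_norm//.
  rewrite (_ : - y + K - _ = K * (1 - q) - q); last by ring.
  by rewrite KE subrr lexx andbT; have := q_lt1; lra.
have [y1|y1] := ltP y 1.
  rewrite /F (phi_ge0 (ltW y0)) phi_le0 ?gtr0_norm//; last by lra.
  have ey : 1 - c * y <= expR (- (c * y)) := expR_ge1Dx (- (c * y)).
  have cy0 : 0 <= c * y by rewrite mulr_ge0// ltW.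
  have ey1 := expRN_le cy0; move: ey ey1; move: (expR _) => e ey ey1.
  rewrite (_ : _ + K - _ = 2 * q * y + 2 / c * (e - 1) + (K * (1 - q) - q));
    last by ring.
  rewrite KE subrr addr0; apply/andP; split.
    have : 2 / c * (- (c * y)) <= 2 / c * (e - 1).
      by rewrite (ler_pM2l c2_gt0); lra.
    rewrite (_ : 2 / c * - (c * y) = - 2 * y); last by field.
    have := q_lt1; nra.
  have -> : 2 * q * y + 2 / c * (e - 1) = 2 / c * (q * (c * y) + (e - 1)) by field.
  rewrite (pmulr_rle0 _ c2_gt0).
  have ycy : c * y <= c by rewrite ler_piMr// ltW.
  have /ler_wpM2r := qc => /(_ _ (ltW y0)).
  have := q_gt0; nra.
have y1' : 0 <= y - 1 by lra.
rewrite /F (phi_ge0 (ltW y0)) (phi_ge0 y1') gtr0_norm//.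
rewrite (_ : - (c * (y - 1)) = - (c * y) + c); last by ring.
have qE : expR c = q^-1 by rewrite /q expRN invrK.
rewrite expRD qE; move: (expR (- (c * y))) => e.
rewrite (_ : _ + K - _ = 2 * q - 2 / c * (1 - q)); last first.
  transitivity (q - 2 / c * (1 - q) + K * (1 - q)); last by rewrite KE; ring.
  by field; rewrite cN0 gt_eqF.
have -> : 2 / c * (1 - q) = 2 * ((1 - q) / c) by field.
have h1 : (1 - q) / c <= 1 by rewrite ler_pdivrMr// mul1r; lra.
have h2 : q <= (1 - q) / c by rewrite ler_pdivlMr//; lra.
by apply/andP; split; lra.
Qed.

Let D : R := 2 / c + K.

(** The errors satisfy d(M + 1) <= q d(M) + 2 (1 - q), with fixed point 2. For M = 0 the mixture is
    |y|, whose distance to [F y] is at most [D]. *)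
Let abs_mixture_dist M y : `|abs_mixture q M y - F y| <= 2 + q ^+ M * D.
Proof.
elim: M y => [|M IH] y.
  rewrite /abs_mixture big_ord1 /tgeom/= expr0 !mul1r subr0.
  have c2 := ltW c2_gt0.
  rewrite /F; have [y0|y0] := leP y 0.
    rewrite phi_le0// (ler0_norm y0) (_ : - y - (- y + K) = - K); last by ring.
    rewrite normrN (ger0_norm K_ge0).
    by rewrite /D; have := K_ge0; lra.
  rewrite (phi_ge0 (ltW y0)) (gtr0_norm y0).
  have ele : expR (- (c * y)) <= 1 by rewrite expR_le1 oppr_le0 mulr_ge0// ltW.
  have ege := expR_ge0 (- (c * y)).
  have : 0 <= 2 / c * (1 - expR (- (c * y))) by rewrite mulr_ge0// subr_ge0.
  have : 0 <= 2 / c * expR (- (c * y)) by rewrite mulr_ge0.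
  rewrite /D ler_norml; have := K_ge0; move: (2 / c) (expR _) => b e ? ? ?.
  by apply/andP; split; lra.
rewrite abs_mixtureS.
have -> : (1 - q) * `|y| + q * abs_mixture q M (y - 1) - F y =
  q * (abs_mixture q M (y - 1) - F (y - 1)) -
  (F y - ((1 - q) * `|y| + q * F (y - 1))) by ring.
rewrite (le_trans (ler_normB _ _))//.
have /andP[d1 d2] := mixture_defect y.
rewrite normrM (gtr0_norm q_gt0) (ler0_norm d2) exprS -mulrA.
have := ler_wpM2l (ltW q_gt0) (IH (y - 1)); lra.
Qed.

Let mixture_error_small : exists M, q ^+ M * D <= 1.
Proof.
have cN0 : c != 0 by rewrite gt_eqF.
have D0 : 0 <= D by rewrite addr_ge0// ltW.
(* M > D / c works, as q^M = expR(- c M) <= 1 / (1 + c M). *)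
exists (Num.bound (D / c)); set M := Num.bound _.
have DM : D < c * M%:R.
  rewrite mulrC -ltr_pdivrMr//; apply: archi_boundP.
  by move: D0 c_gt0; move: D c => d e d0 e0'; rewrite divr_ge0// ltW.
have := expRN_le (ltW (le_lt_trans D0 DM)).
have -> : expR (- (c * M%:R)) = q ^+ M by rewrite -mulNr expRM_natr.
have : 0 <= q ^+ M by rewrite exprn_ge0// ltW.
by nra.
Qed.

Lemma measurable_phi_c1 : measurable_fun setT (phi_c1 eps).
Proof.
apply: measurable_fun_ifT => //=.
- by apply: measurable_fun_ler.
- apply: measurable_funB => //; apply: measurable_funD => //.
  apply: measurable_funM => //; apply: measurableT_comp => //.
  by apply: measurable_funM => //; exact: measurable_funM.
Qed.

Lemma gauss_integrable_phi_c1 x s : 0 < s -> gauss_integrable x s (phi_c1 eps).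
Proof.
move=> s0.
apply: (gauss_integrable_le measurable_phi_c1
  (gauss_integrableD (gauss_integrable_abs x 0 s0)
     (gauss_integrable_cst x s (2 / c)))) => y.
have c2 := ltW c2_gt0.
rewrite subr0; have [y0|y0] := leP y 0.
  by rewrite phi_le0// normrN lerDl.
rewrite (phi_ge0 (ltW y0)) (le_trans (ler_normD _ _))// lerD2l.
rewrite normrM (ger0_norm c2) ler_piMr//.
have ele : expR (- (c * y)) <= 1 by rewrite expR_le1 oppr_le0 mulr_ge0// ltW.
have ege := expR_ge0 (- (c * y)).
by rewrite ler_norml; apply/andP; split; lra.
Qed.

(** For a suitable [M] the mixture is within 3 of [F], so exchanging them costs 3 for the walk and 3
    for the Gaussian. As the weights sum to 1, the bound for each |. - i| passes to the mixture
    whatever the size of [M]. *)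
Lemma walk_phi_clt x n : (0 < n)%N ->
  `|iter n (walk eps) (phi_c1 eps) x -
    gauss x (Num.sqrt (kappa_of eps * n%:R)) (phi_c1 eps)| <=
  5000 * (1 + eps ^+ 2 * n%:R) + 6.
Proof.
move=> n0; set s := Num.sqrt _; set B := 5000 * _.
have s0 : 0 < s by rewrite sqrtr_gt0 mulr_gt0 ?kappa_gt0 ?ltr0n.
have [M hM] := mixture_error_small.
have dist y : `|abs_mixture q M y - F y| <= 3.
  by rewrite (le_trans (abs_mixture_dist M y))//; lra.
have gph := gauss_integrable_phi_c1 x s0.
have gF : gauss_integrable x s F.
  by apply: gauss_integrableD => //; exact: gauss_integrable_cst.
have gw i : gauss_integrable x s (fun y => tgeom q M i * `|y - i%:R|).
  exact/gauss_integrableZ/gauss_integrable_abs.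
have gpsi : gauss_integrable x s (abs_mixture q M).
  exact: (gauss_integrable_sum _ (fun i : 'I_M.+1 => gw i)).
have d1 := iter_walk_dist_le n x (ltW e0) (ltW e1) dist.
have d2 := gauss_dist_le gpsi gF dist.
have d3 : `|iter n (walk eps) (abs_mixture q M) x -
    gauss x s (abs_mixture q M)| <= B.
  rewrite (iter_walk_sum eps n _ (fun (i : 'I_M.+1) y => tgeom q M i * `|y - i%:R|)).
  rewrite (gauss_sum _ (fun i : 'I_M.+1 => gw i)) -sumrB.
  rewrite (le_trans (ler_norm_sum _ _ _))//.
  rewrite -[leRHS]mul1r -(sum_tgeom q M) mulr_suml; apply: ler_sum => i _.
  rewrite iter_walkZ gaussZ; last exact: gauss_integrable_abs.
  have w0 := tgeom_ge0 M i (ltW q_gt0) (ltW q_lt1).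
  rewrite -mulrBr normrM (ger0_norm w0) (ler_wpM2l w0)//.
  by rewrite gauss_abs//; exact: walk_abs_clt.
have <- : iter n (walk eps) F x - gauss x s F =
    iter n (walk eps) (phi_c1 eps) x - gauss x s (phi_c1 eps).
  rewrite iter_walkD gaussD// ?gauss_cst; last exact: gauss_integrable_cst.
  by rewrite opprD addrACA subrr addr0.
move: d1 d2 d3; rewrite !ler_distl => /andP[? ?] /andP[? ?] /andP[? ?].
by apply/andP; split; lra.
Qed.

End fixed_eps.
End PhiMixture.

(** * Expansions of [nu] and [rho] as eps tends to 0 *)

Section Asymptotics.
Context {R : realType}.
Implicit Types (eps x : R) (n : nat).

Let expR_taylor n x : `|x| <= 1 ->
  `|expR x - \sum_(k < n) x ^+ k / k`!%:R| <= expR 1 * `|x| ^+ n.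
Proof.
move=> x1; have := @taylor_le R (fun=> expR) n 0 x (expR 1).
rewrite add0r; under eq_bigr do rewrite expR0 mul1r.
apply=> t /andP[t0 t1].
rewrite ger0_norm ?expR_ge0// ler_expR add0r.
by rewrite (le_trans (ler_norm _))// normrM ger0_norm// mulr_ile1.
Qed.

Let expR_taylor4 x : `|x| <= 1 ->
  `|expR x - (1 + x + x ^+ 2 / 2 + x ^+ 3 / 6)| <= expR 1 * `|x| ^+ 4.
Proof.
move=> /(expR_taylor 4); congr (`|_ - _| <= _).
by rewrite !big_ord_recl !big_ord0 /= /bump /= !factS fact0; field.
Qed.

Let expR_taylor5 x : `|x| <= 1 ->
  `|expR x - (1 + x + x ^+ 2 / 2 + x ^+ 3 / 6 + x ^+ 4 / 24)| <=
  expR 1 * `|x| ^+ 5.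
Proof.
move=> /(expR_taylor 5); congr (`|_ - _| <= _).
by rewrite !big_ord_recl !big_ord0 /= /bump /= !factS fact0; field.
Qed.

(** The eps^2 terms of [nu] cancel, so the eps^3 term left after multiplying by kappa / eps collects
    contributions of all powers of c up to the fourth. *)
Lemma nu_asymptotics eps : 0 < eps -> eps <= 4^-1 ->
  `|kappa_of eps / eps * nu eps - 4 / 3 * eps ^+ 3| <=
  (4 + 200 * expR 1) * eps ^+ 4.
Proof.
move=> e0 e4; rewrite /nu.
have eN0 : eps != 0 by rewrite gt_eqF.
have k34 : 3 / 4 <= kappa_of eps by (rewrite /kappa_of; nra).
have kN0 : kappa_of eps != 0 by (rewrite gt_eqF//; lra).
set c := 2 * eps / kappa_of eps.
have c0 : 0 <= c by (rewrite divr_ge0 ?mulr_ge0 ?ltW//; lra).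
have c83 : c <= 8 / 3 * eps by (rewrite ler_pdivrMr; [nra|lra]).
have -> : - 2 * eps / kappa_of eps = - c by rewrite /c; field.
have cn : `|c| <= 1 by (rewrite ger0_norm//; lra).
have cnN : `|- c| <= 1 by rewrite normrN.
have := expR_taylor5 cn; have := expR_taylor5 cnN.
rewrite normrN (ger0_norm c0).
move: (expR (- c)) (expR c) (expR 1) (expR_ge0 (1 : R)) => E1 E2 M M0 H1 H2.
(* (8/3)^5 < 200. *)
have c5 : c ^+ 5 <= 200 * eps ^+ 5.
  rewrite (@le_trans _ _ ((8 / 3 * eps) ^+ 5))//.
    by rewrite lerXn2r// nnegrE// mulr_ge0// ltW.
  have : 0 <= eps ^+ 5 by rewrite exprn_ge0// ltW.
  by rewrite exprMn; lra.
(* [nu] with the exponentials cut after c^4: even powers get weight 1, odd powers weight - eps. *)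
pose P := c ^+ 2 / 2 + c ^+ 4 / 24 - eps * c - eps * c ^+ 3 / 6.
have HP : `|E1 * ((1 + eps) / 2) + E2 * ((1 - eps) / 2) - 1 - P| <=
    M * (200 * eps ^+ 5).
  apply: (@le_trans _ _ (M * c ^+ 5)); last by rewrite ler_wpM2l.
  move: H1 H2; set d1 := E1 - _; set d2 := E2 - _.
  have -> : E1 * ((1 + eps) / 2) + E2 * ((1 - eps) / 2) - 1 - P =
    (1 + eps) / 2 * d1 + (1 - eps) / 2 * d2 by rewrite /d1 /d2 /P; field.
  rewrite !ler_norml; move: d1 d2 (M * _) => d1 d2 D /andP[? ?] /andP[? ?].
  by apply/andP; split; nra.
pose k := (kappa_of eps)^-1.
have k1 : 1 <= k by (rewrite invf_ge1 ?gerBl ?sqr_ge0//; lra).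
have k2 : k <= 4 / 3 by (rewrite invf_ple ?posrE//; lra).
have ke : k - 1 = eps ^+ 2 * k by rewrite /k /kappa_of; field.
have PE : kappa_of eps / eps * P =
    eps ^+ 3 * (4 / 3 + (k - 1) * (2 / 3 * k ^+ 2 - 2 / 3 * k + 4 / 3)).
  rewrite /P /c /k; move: kN0; rewrite /kappa_of => kN0.
  by field; rewrite eN0 kN0.
set V := _ + _ - 1; have -> : kappa_of eps / eps * V - 4 / 3 * eps ^+ 3 =
    kappa_of eps / eps * (V - P) +
    eps ^+ 3 * ((k - 1) * (2 / 3 * k ^+ 2 - 2 / 3 * k + 4 / 3)).
  by rewrite [_ * (V - P)]mulrBr PE; ring.
rewrite (le_trans (ler_normD _ _))// [leRHS]mulrDl [leLHS]addrC lerD//.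
  rewrite ger0_norm; last first.
    rewrite mulr_ge0 ?exprn_ge0 ?(ltW e0)// mulr_ge0//; first by lra.
    by nra.
  rewrite [leRHS](_ : _ = eps ^+ 3 * (4 * eps)); last by ring.
  rewrite ler_wpM2l ?exprn_ge0 ?(ltW e0)//.
  have : 2 / 3 * k ^+ 2 - 2 / 3 * k + 4 / 3 <= 2 by nra.
  have : k - 1 <= 2 * eps by rewrite ke; nra.
  by nra.
rewrite normrM ger0_norm; last by (rewrite divr_ge0 ?ltW//; lra).
have -> : 200 * M * eps ^+ 4 = 1 / eps * (M * (200 * eps ^+ 5)) by field.
apply: ler_pM => //; first by rewrite divr_ge0 ?ltW//; lra.
rewrite ler_pM2r ?invr_gt0// /kappa_of gerBl sqr_ge0//.
Qed.

(** The constant and first-order terms cancel, and cutting the exponential after c^3 captures the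
    whole eps^2 coefficient, 1 - 2/3. *)
Lemma rho_asymptotics eps : 0 < eps -> eps <= 4^-1 ->
  `|kappa_of eps / eps * rho eps + 1 - 3^-1 * eps ^+ 2| <=
  (5 + 100 * expR 1) * eps ^+ 3.
Proof.
move=> e0 e4; rewrite /rho.
have eN0 : eps != 0 by rewrite gt_eqF.
have k34 : 3 / 4 <= kappa_of eps by (rewrite /kappa_of; nra).
have kN0 : kappa_of eps != 0 by (rewrite gt_eqF//; lra).
set c := 2 * eps / kappa_of eps.
have c0 : 0 <= c by (rewrite divr_ge0 ?mulr_ge0 ?ltW//; lra).
have c83 : c <= 8 / 3 * eps by (rewrite ler_pdivrMr; [nra|lra]).
have -> : - 2 * eps / kappa_of eps = - c by rewrite /c; field.
have cn : `|- c| <= 1 by (rewrite normrN ger0_norm//; lra).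
have := expR_taylor4 cn; rewrite normrN (ger0_norm c0).
move: (expR (- c)) (expR 1) (expR_ge0 (1 : R)) => E M M0 H1.
have c4 : c ^+ 4 <= 100 * eps ^+ 4.
  rewrite (@le_trans _ _ ((8 / 3 * eps) ^+ 4))//.
    by rewrite lerXn2r// nnegrE// mulr_ge0// ltW.
  have : 0 <= eps ^+ 4 by rewrite exprn_ge0// ltW.
  by rewrite exprMn; lra.
pose P := - c + c ^+ 2 / 2 - c ^+ 3 / 6.
have HP : `|E - 1 - P| <= M * (100 * eps ^+ 4).
  apply: (@le_trans _ _ (M * c ^+ 4)); last by rewrite ler_wpM2l.
  by move: H1; congr (`|_| <= _); rewrite /P; field.
pose k := (kappa_of eps)^-1.
have k1 : 1 <= k by (rewrite invf_ge1 ?gerBl ?sqr_ge0//; lra).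
have k2 : k <= 4 / 3 by (rewrite invf_ple ?posrE//; lra).
have ke : k - 1 = eps ^+ 2 * k by rewrite /k /kappa_of; field.
pose Q := (1 + eps) * (3^-1 - eps ^+ 2) * k ^+ 2.
have PE : kappa_of eps / eps * (P * ((1 + eps) / 2)) + 1 = eps ^+ 2 * Q.
  rewrite /Q /P /c /k; move: kN0; rewrite /kappa_of => kN0.
  by field; rewrite eN0 kN0.
have -> : kappa_of eps / eps * ((E - 1) * ((1 + eps) / 2)) + 1 -
    3^-1 * eps ^+ 2 =
    kappa_of eps / eps * ((1 + eps) / 2) * (E - 1 - P) +
    eps ^+ 2 * (Q - 3^-1).
  by rewrite [_ * (Q - _)]mulrBr -PE; field.
rewrite (le_trans (ler_normD _ _))// [leRHS]mulrDl [leLHS]addrC lerD//.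
  rewrite normrM ger0_norm ?sqr_ge0// [leRHS](_ : _ = eps ^+ 2 * (5 * eps)); last by ring.
  rewrite ler_wpM2l ?sqr_ge0//.
  have k3 : k ^+ 2 - 1 <= 5 * eps ^+ 2.
    by (rewrite (_ : k ^+ 2 - 1 = (k - 1) * (k + 1)); [rewrite ke; nra|ring]).
  have k4 : 0 <= k ^+ 2 - 1 by nra.
  rewrite /Q; move: (k ^+ 2) k3 k4 => K k3 k4.
  have w1 : (1 + eps) * (3^-1 - eps ^+ 2) <= 3^-1 + eps by nra.
  have w2 : 3^-1 - eps <= (1 + eps) * (3^-1 - eps ^+ 2) by nra.
  move: (_ * _) w1 w2 => w w1 w2; have e2 : eps ^+ 2 <= eps / 4 by nra.
  have w3 : 0 <= w * (K - 1) by rewrite mulr_ge0//; lra.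
  have w4 : w * (K - 1) <= 1 * (5 * eps ^+ 2) by apply: ler_pM => //; lra.
  by rewrite ler_norml; apply/andP; split; lra.
rewrite normrM ger0_norm; last by (rewrite mulr_ge0// ?divr_ge0 ?ltW//; lra).
have -> : 100 * M * eps ^+ 3 = 1 / eps * (M * (100 * eps ^+ 4)) by field.
apply: ler_pM => //; first by rewrite mulr_ge0// ?divr_ge0 ?ltW//; lra.
rewrite mulrAC ler_pM2r ?invr_gt0//.
have : kappa_of eps <= 1 by rewrite gerBl sqr_ge0.
by nra.
Qed.

Lemma equiv_right_of_le (f : R -> R) (a C : R) n : 0 < a -> 0 <= C ->
  (forall eps, 0 < eps -> eps <= 4^-1 ->
    `|f eps - a * eps ^+ n| <= C * eps ^+ n.+1) ->
  f ~_(0^'+) (fun eps => a * eps ^+ n).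
Proof.
move=> a0 C0 H; apply/eqaddoP => e e0; near=> eps.
have eps0 : 0 < eps by near: eps; exact: nbhs_right_gt.
have eps4 : eps <= 4^-1 by near: eps; apply: nbhs_right_le; rewrite invr_gt0.
(* [C + 1] keeps the denominator positive when [C = 0]. *)
have epsC : eps <= e * a / (C + 1).
  by near: eps; apply: nbhs_right_le; rewrite divr_gt0 ?mulr_gt0//; lra.
apply: (le_trans (H _ eps0 eps4)).
rewrite [X in _ <= _ * X]ger0_norm; last by rewrite mulr_ge0 ?exprn_ge0// ltW.
rewrite exprS !mulrA ler_wpM2r ?exprn_ge0// ?ltW//.
move: epsC; rewrite ler_pdivlMr; last by lra.
by nra.
Unshelve. all: by end_near. Qed.

End Asymptotics.

(** * Comparison of [u] with the value function *)

Section Assembly.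
Context {R : realType}.
Implicit Types (eps x z : R) (n T : nat).

Let Phi_normal_pdf (kappa x s : R) n : 0 < kappa -> (0 < n)%N ->
  Phi kappa (x - s) (- n%:R) = normal_pdf x (Num.sqrt (kappa * n%:R)) s.
Proof.
move=> k0 n0; have kn : 0 < kappa * n%:R by rewrite mulr_gt0 ?ltr0n.
rewrite normal_pdfE; last by rewrite gt_eqF// sqrtr_gt0.
rewrite /Phi /normal_peak /normal_fun sqr_sqrtr ?(ltW kn)//.
congr ((Num.sqrt _)^-1 * expR _).
  by rewrite -mulr_natr; ring.
rewrite -mulr_natr; field.
by rewrite !gt_eqF ?ltr0n.
Qed.

Lemma phihat_gauss eps x n : 0 < eps -> eps < 1 -> (0 < n)%N ->
  phihat eps (kappa_of eps) (kappa_of eps) (kappa_of eps / eps) x (- n%:R) =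
  gauss x (Num.sqrt (kappa_of eps * n%:R)) (phi_c1 eps).
Proof.
move=> e0 e1 n0; apply: eq_Rintegral => s _.
by rewrite Phi_normal_pdf// kappa_gt0.
Qed.

(** The doubled time gives the variance of the [n.*2] walk steps made by xi^h + xi^r. *)
Lemma u_h_gauss eps z n : 0 < eps -> eps < 1 -> (0 < n)%N ->
  u_h (kappa_of eps) 0 z (- n%:R) =
  2^-1 * gauss z (Num.sqrt (kappa_of eps * n.*2%:R)) (fun y => `|y - 0|).
Proof.
move=> e0 e1 n0; rewrite /u_h add0r; congr (_ * _).
apply: eq_Rintegral => s _.
have -> : 2 * - n%:R = - n.*2%:R :> R by rewrite mulrN -natrM mul2n.
by rewrite Phi_normal_pdf ?kappa_gt0 ?double_gt0// subr0.
Qed.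

Lemma regret_dist_le : exists2 C : R, 0 < C & forall eps T,
  0 < eps -> eps < 1 -> (0 < T)%N ->
  `|u eps (kappa_of eps) (kappa_of eps) (kappa_of eps / eps) 0
      (eps * T%:R, eps * T%:R) (- T%:R) -
    v eps 0 (eps * T%:R, eps * T%:R) (- T%:Z)| <=
  C * (1 + local_error eps * T%:R).
Proof.
(* The bounds add up to 7506 + 10000 eps^2 T + local_error T, and eps^2 T <= 12 local_error T. *)
exists (5000 * 30) => [|eps T e0 e1 T0]; first by rewrite mulr_gt0 ?ltr0n.
rewrite /u /u_n phihat_gauss// u_h_gauss// /v abszN /= mulrN subrr.
set x := eps * T%:R.
(* The starting state has xi^r + eps t = 0, so [phi_c1 eps 0] occurs in both expressions and
   cancels. *)
have x0 : (x, x).2 - eps * T%:R = 0%:~R by rewrite subrr.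
have := value_to_go_dist 0 e0 e1 x0; rewrite /= add0r.
have T2 : (0 < T.*2)%N by rewrite double_gt0.
have kappaT2 : 0 < Num.sqrt (kappa_of eps * T.*2%:R).
  by rewrite sqrtr_gt0 mulr_gt0 ?kappa_gt0 ?ltr0n.
have := walk_abs_clt 0 (x + x) e0 e1 T2; rewrite -gauss_abs//.
have := walk_phi_clt e0 e1 x T0.
have := local_error_ge e0 e1.
have -> : T.*2%:R = 2 * T%:R :> R by rewrite -natrM mul2n.
have : (0 : R) < T%:R by rewrite ltr0n.
rewrite -/(phi_c1 eps 0); move: (T%:R : R) (local_error eps) => t A.
move: (gauss _ _ _) (gauss _ _ _) (iter _ _ _ _) (iter _ _ _ _) (value_to_go _ _ _ _).
move=> G1 G2 I1 I2 V t0 HA; rewrite !ler_distl => /andP[? ?] /andP[? ?] /andP[? ?].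
have : eps ^+ 2 * t <= 12 * (A * t) by rewrite mulrA ler_pM2r//; lra.
by move=> ?; apply/andP; split; lra.
Qed.

End Assembly.

Theorem mainTheorem2 (R : realType) :
  exists E1 : R -> int -> R,
    (forall (eps : R) (T : nat), 0 < eps -> eps < 1 -> (1 <= T)%N ->
       let kappa := kappa_of eps in
       let xi0 := (eps * T%:R, eps * T%:R) in
       `| u eps kappa kappa (kappa / eps) 0 xi0 (- T%:R)
          - v eps 0 xi0 (- T%:Z) | <= E1 eps (- T%:Z)) /\
    (exists C : R, forall (eps : R) (T : nat),
       0 < eps -> eps < 1 -> (1 <= T)%N ->
       let kappa := kappa_of eps in
       `| E1 eps (- T%:Z) | <=
         C * (1 + Num.sqrt kappa
              + (kappa / eps * nu eps + kappa / eps * rho eps + 1) * T%:R)) /\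
    (fun eps : R => kappa_of eps / eps * nu eps)
      ~_(0^'+) (fun eps : R => 4 / 3 * eps ^+ 3) /\
    (fun eps : R => kappa_of eps / eps * rho eps + 1)
      ~_(0^'+) (fun eps : R => 3^-1 * eps ^+ 2) /\
    (exists C : R, \forall eps \near 0^'+, forall T : nat, (1 <= T)%N ->
       `| E1 eps (- T%:Z) | <= C * (1 + eps ^+ 2 * T%:R)).
Proof.
have [C C0 distC] := regret_dist_le (R := R).
(* The bound of [regret_dist_le] is itself the error term; the O-estimate then holds with the same
   [C], since [Num.sqrt kappa] is nonnegative. *)
exists (fun eps t => C * (1 + local_error eps * `|t|%N%:R)).
have E1_ge0 (eps : R) T : 0 < eps -> eps < 1 ->
    0 <= C * (1 + local_error eps * T%:R).
  move=> e0 e1; rewrite mulr_ge0 ?(ltW C0)// addr_ge0// mulr_ge0//.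
  by rewrite (le_trans _ (local_error_ge e0 e1))// divr_ge0// sqr_ge0.
have M0 := expR_ge0 (1 : R).
split; [|split; [|split; [|split]]].
- move=> eps T e0 e1 T0.
  rewrite abszN absz_nat.
  exact: distC.
- exists C => eps T e0 e1 T0 /=.
  rewrite abszN absz_nat ger0_norm ?E1_ge0// ler_pM2l// lerD2r lerDl.
  exact: sqrtr_ge0.
- by apply: equiv_right_of_le (@nu_asymptotics R); lra.
- by apply: equiv_right_of_le (@rho_asymptotics R); lra.
(* For eps <= 1/4 both expansions apply, and eps^3 and eps^4 are at most eps^2; 20 + 600 [expR 1]
   generously dominates the collected coefficients. *)
- exists (C * (20 + 600 * expR 1)); near=> eps => T T0.
  have e0 : 0 < eps by near: eps; exact: nbhs_right_gt.
  have e4 : eps <= 4^-1 by near: eps; apply: nbhs_right_le; rewrite invr_gt0.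
  have e1 : eps < 1 by lra.
  rewrite abszN absz_nat ger0_norm ?E1_ge0// -mulrA ler_pM2l//.
  have t0 : (0 : R) <= T%:R by exact: ler0n.
  have := nu_asymptotics e0 e4; have := rho_asymptotics e0 e4.
  rewrite !ler_distl => /andP[_ rhoE] /andP[_ nuE].
  have e3 : eps ^+ 3 <= eps ^+ 2 by rewrite ler_wiXn2l// ltW.
  have e5 : eps ^+ 4 <= eps ^+ 2 by rewrite ler_wiXn2l// ltW.
  have Me3 : (9 + 300 * expR 1) * eps ^+ 3 <= (9 + 300 * expR 1) * eps ^+ 2.
    by apply: ler_wpM2l e3; lra.
  have Me4 : (9 + 300 * expR 1) * eps ^+ 4 <= (9 + 300 * expR 1) * eps ^+ 2.
    by apply: ler_wpM2l e5; lra.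
  have loc : local_error eps <= (20 + 600 * expR 1) * eps ^+ 2.
    have := exprn_ge0 3 (ltW e0); have := exprn_ge0 4 (ltW e0).
    have := mulr_ge0 M0 (exprn_ge0 3 (ltW e0)).
    have := mulr_ge0 M0 (exprn_ge0 4 (ltW e0)).
    by rewrite /local_error; lra.
  have := ler_wpM2r t0 loc; have := mulr_ge0 (sqr_ge0 eps) t0.
  have := mulr_ge0 M0 (mulr_ge0 (sqr_ge0 eps) t0); lra.
Unshelve. all: by end_near. Qed.
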